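(* Let $\mathcal{E}$ be a strict monoidal $\infty$-category with unit $\mathbb{1}$, and let $(x,\eta_t)$ be a terminal object of the $\infty$-category of coaugmented objects $\mathcal{E}^{\mathbb{1}/}$. Then any $\infty$-monoid structure on the coaugmented object $(x,\eta_t)$ (i.e. any object of $\mathsf{mon}_\infty(\mathcal{E},x,\eta_t)$) defines a terminal object of $\mathsf{mon}_\infty(\mathcal{E})$, and the Kan complex of $\infty$-monoid structures $\mathsf{mon}_\infty(\mathcal{E},x,\eta_t)$ is (non-empty and) contractible.
   Context: An $\infty$-category means a quasi-category. $\mathsf{sMon}$ is the category of simplicial monoids (simplicial objects in monoids). For a simplicial set $S$ and a simplicial monoid $M$, $S\otimes M$ is the simplicial monoid with $(S\otimes M)_n=\coprod_{s\in S_n}M_n$ (coproduct of monoids), and $\mathsf{Map}(M,N)$ is the simplicial set with $\mathsf{Map}(M,N)_n=\mathrm{Hom}_{\mathsf{sMon}}(\Delta^n\otimes M,N)$. A strict monoidal $\infty$-category is a simplicial monoid $\mathcal{E}$ whose underlying simplicial set is an $\infty$-category; we use the same letter for the underlying $\infty$-category, and $\mathbb{1}$ is its unit object. $\Delta_+$ is the category of finite ordinals $[n]=\{0,\dots,n\}$, $n\ge -1$, with $[-1]=\emptyset$, and monotone maps; it is strict monoidal under the join $[n]\star[m]=[n+m+1]$ with unit $[-1]$. Its nerve $\mathrm{N}(\Delta_+)$ is thus a simplicial monoid. An $\infty$-monoid in $\mathcal{E}$ is a morphism of simplicial monoids $\mathcal{M}:\mathrm{N}(\Delta_+)\to\mathcal{E}$,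 and the $\infty$-category of $\infty$-monoids is $\mathsf{mon}_\infty(\mathcal{E})=\mathsf{Map}(\mathrm{N}(\Delta_+),\mathcal{E})$ (this is an $\infty$-category). $\mathcal{E}^{\mathbb{1}/}$ is the fat slice, i.e. the fiber over $\mathbb{1}$ of evaluation at $0$, $\mathcal{E}^{\Delta^1}\to\mathcal{E}$; its objects are coaugmented objects $(x,\eta:\mathbb{1}\to x)$. The forgetful functor $\mathsf{mon}_\infty(\mathcal{E})\to\mathcal{E}^{\mathbb{1}/}$ is restriction along the $1$-simplex $\Delta^1\to\mathrm{N}(\Delta_+)$ given by the morphism $[-1]\to[0]$; it sends $\mathcal{M}$ to $\mathcal{M}([-1]\to[0]):\mathbb{1}\to\mathcal{M}([0])$. For a coaugmented object $(x,\eta)$, $\mathsf{mon}_\infty(\mathcal{E},x,\eta)$ is the fiber of this forgetful functor over $(x,\eta)$; it is a Kan complex whose objects are called $\infty$-monoid structures on $(x,\eta)$. *)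

(* Defs.v *)
From HB Require Import structures.
From mathcomp Require Import all_boot boolp.

Set Implicit Arguments.
Unset Strict Implicit.
Unset Printing Implicit Defensive.

Local Open Scope quotient_scope.
Local Open Scope group_scope.

(* [ordmap k l] is the set of monotone maps {0,...,k-1} -> {0,...,l-1}, i.e.
   of morphisms [k-1] -> [l-1] of Delta_+. *)
Record ordmap (k l : nat) := Ordmap {
  ordmap_fun :> {ffun 'I_k -> 'I_l};
  ordmapP : [forall i : 'I_k, forall j : 'I_k, (i <= j) ==> (ordmap_fun i <= ordmap_fun j)]
}.

HB.instance Definition _ k l := [isSub for @ordmap_fun k l].

Lemma ordmap_mono k l (f : ordmap k l) (i j : 'I_k) : i <= j -> f i <= f j.
Proof. by move=> ij; have /forallP/(_ i)/forallP/(_ j)/implyP := ordmapP f; apply. Qed.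

Lemma ordmap_ext k l (f g : ordmap k l) : f =1 g -> f = g.
Proof. by move=> fg; apply/val_inj/ffunP. Qed.

Definition mk_ordmap k l (f : 'I_k -> 'I_l)
    (f_mono : forall i j : 'I_k, i <= j -> f i <= f j) : ordmap k l.
Proof.
exists (finfun f).
by apply/forallP => i; apply/forallP => j; apply/implyP => ij; rewrite !ffunE f_mono.
Defined.

Lemma mk_ordmapE k l (f : 'I_k -> 'I_l) f_mono i : @mk_ordmap k l f f_mono i = f i.
Proof. by rewrite ffunE. Qed.

Definition ordmap_id k : ordmap k k := mk_ordmap (f := id) (fun i j ij => ij).

Definition ordmap_comp k l m (g : ordmap l m) (f : ordmap k l) : ordmap k m :=
  mk_ordmap (f := g \o f) (fun i j ij => ordmap_mono g (ordmap_mono f ij)).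

Definition ordmap_const k l (i : 'I_l) : ordmap k l :=
  mk_ordmap (f := fun _ => i) (fun _ _ _ => leqnn i).

Definition ordmap_widen k l (kl : k <= l) : ordmap k l :=
  mk_ordmap (f := widen_ord kl) (fun i j ij => ij).

Lemma ordmap_idE k i : ordmap_id k i = i. Proof. exact: mk_ordmapE. Qed.

Lemma ordmap_compE k l m (g : ordmap l m) (f : ordmap k l) i :
  ordmap_comp g f i = g (f i).
Proof. exact: mk_ordmapE. Qed.

Lemma ordmap_compA k l m n (h : ordmap m n) (g : ordmap l m) (f : ordmap k l) :
  ordmap_comp h (ordmap_comp g f) = ordmap_comp (ordmap_comp h g) f.
Proof. by apply: ordmap_ext => i; rewrite !ordmap_compE. Qed.

Lemma ordmap_comp1m k l (f : ordmap k l) : ordmap_comp (ordmap_id l) f = f.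
Proof. by apply: ordmap_ext => i; rewrite ordmap_compE ordmap_idE. Qed.

Lemma ordmap_compm1 k l (f : ordmap k l) : ordmap_comp f (ordmap_id k) = f.
Proof. by apply: ordmap_ext => i; rewrite ordmap_compE ordmap_idE. Qed.

Notation simp m n := (ordmap m.+1 n.+1).

Record sset := SSet {
  sset_ob :> nat -> Type;
  act : forall m n, simp m n -> sset_ob n -> sset_ob m;
  act_id : forall n (x : sset_ob n), act (ordmap_id n.+1) x = x;
  act_comp : forall l m n (g : simp m n) (f : simp l m) (x : sset_ob n),
    act (ordmap_comp g f) x = act f (act g x)
}.
Arguments act {s m n}.

Record sset_hom (X Y : sset) := SSetHom {
  sset_fun :> forall n, X n -> Y n;
  sset_nat : forall m n (f : simp m n) (x : X n),
    sset_fun (act f x) = act f (sset_fun x)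
}.

Lemma sset_hom_ext (X Y : sset) (f g : sset_hom X Y) :
  (forall n (x : X n), f n x = g n x) -> f = g.
Proof.
case: f g => [f fn] [g gn] /= fg.
have {}fg : f = g by apply: functional_extensionality_dep => n; apply/funext/fg.
by case: _ / fg gn => gn; rewrite (Prop_irrelevance fn gn).
Qed.

Definition sset_comp (X Y Z : sset) (g : sset_hom Y Z) (f : sset_hom X Y) : sset_hom X Z.
Proof.
by exists (fun n x => g n (f n x)) => m n a x; rewrite !sset_nat.
Defined.

(* The iterated degeneracy at level n of a vertex. *)
Definition degen (X : sset) (x : X 0) n : X n := act (ordmap_const n.+1 ord0) x.

Section Subset.
Variables (X : sset) (P : forall n, X n -> Prop).
Hypothesis P_act : forall m n (f : simp m n) x, P x -> P (act f x).

Definition sub_sset : sset.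
Proof.
exists (fun n => {x : X n | P x})
       (fun m n f x => exist _ (act f (sval x)) (P_act f (svalP x))).
- by move=> n [x Px]; apply: eq_exist; rewrite act_id.
- by move=> l m n g f [x Px]; apply: eq_exist; rewrite /= act_comp.
Defined.

Definition sub_incl : sset_hom sub_sset X.
Proof. by exists (fun n => @sval (X n) (@P n)). Defined.
End Subset.

Definition std_simplex (n : nat) : sset.
Proof.
exists (fun m => simp m n) (fun l m f g => ordmap_comp g f).
- by move=> m f; exact: ordmap_compm1.
- by move=> k l m g f x; exact: ordmap_compA.
Defined.

Definition vertex n (i : 'I_n.+1) : std_simplex n 0 := ordmap_const 1 i.

(* m-simplices of Delta^n missing some vertex j, resp. some vertex j other than k. *)
Definition in_boundary n m (f : std_simplex n m) : bool :=
  [exists j, forall i, f i != j].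

Definition in_horn n (k : 'I_n.+1) m (f : std_simplex n m) : bool :=
  [exists j, (j != k) && [forall i, f i != j]].

Lemma in_boundary_act n l m (g : simp l m) (f : std_simplex n m) :
  in_boundary f -> in_boundary (act g f).
Proof.
by case/existsP=> j /forallP fj; apply/existsP; exists j; apply/forallP => i;
  rewrite ordmap_compE.
Qed.

Lemma in_horn_act n (k : 'I_n.+1) l m (g : simp l m) (f : std_simplex n m) :
  in_horn k f -> in_horn k (act g f).
Proof.
case/existsP=> j /andP[jk /forallP fj]; apply/existsP; exists j; rewrite jk /=.
by apply/forallP => i; rewrite ordmap_compE.
Qed.

Definition boundary n : sset :=
  sub_sset (P := fun m f => in_boundary f) (@in_boundary_act n).
Definition boundary_incl n : sset_hom (boundary n) (std_simplex n) :=
  sub_incl (@in_boundary_act n).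

Definition horn n (k : 'I_n.+1) : sset :=
  sub_sset (P := fun m f => in_horn k f) (@in_horn_act n k).
Definition horn_incl n (k : 'I_n.+1) : sset_hom (horn k) (std_simplex n) :=
  sub_incl (@in_horn_act n k).

Lemma vertex_in_boundary n (i : 'I_n.+2) : in_boundary (vertex i).
Proof.
apply/existsP; exists (if i == ord0 then ord_max else ord0).
by apply/forallP => j; rewrite mk_ordmapE; case: (eqVneq i ord0) => [->|].
Qed.

Definition boundary_vertex n (i : 'I_n.+2) : boundary n.+1 0 :=
  exist _ (vertex i) (vertex_in_boundary i).

Definition extends (X A B : sset) (i : sset_hom A B) (h : sset_hom A X) : Prop :=
  exists s : sset_hom B X, sset_comp s i = h.

Definition quasi_category (X : sset) : Prop :=
  forall n (k : 'I_n.+1), 0 < k < n ->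
  forall h : sset_hom (horn k) X, extends (horn_incl k) h.

Definition kan_complex (X : sset) : Prop :=
  forall n (k : 'I_n.+2) (h : sset_hom (horn k) X), extends (horn_incl k) h.

(* The map X -> Delta^0 is a trivial fibration; the case n = 0 says that X is
   non-empty. *)
Definition contractible (X : sset) : Prop :=
  forall n (h : sset_hom (boundary n) X), extends (boundary_incl n) h.

(* Joyal's definition: every sphere of dimension >= 1 whose last vertex is x can be
   filled; equivalently, the slice projection X_{/x} -> X is a trivial fibration. *)
Definition terminal (X : sset) (x : X 0) : Prop :=
  forall n (h : sset_hom (boundary n.+1) X),
    h 0 (boundary_vertex ord_max) = x -> extends (boundary_incl n.+1) h.

Definition sset_prod (X Y : sset) : sset.
Proof.
exists (fun n => (X n * Y n)%type) (fun m n f xy => (act f xy.1, act f xy.2)).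
- by move=> n [x y]; rewrite !act_id.
- by move=> l m n g f [x y]; rewrite !act_comp.
Defined.

Definition simplex_map m n (f : simp m n) : sset_hom (std_simplex m) (std_simplex n).
Proof.
by exists (fun l (g : simp l m) => ordmap_comp f g) => k l g h; apply: ordmap_compA.
Defined.

Definition sset_exp_act (X K : sset) m n (f : simp m n)
  (phi : sset_hom (sset_prod (std_simplex n) K) X) :
  sset_hom (sset_prod (std_simplex m) K) X.
Proof.
exists (fun l (p : sset_prod (std_simplex m) K l) => phi l (simplex_map f l p.1, p.2)).
by move=> k l g [h x]; rewrite -sset_nat /= ordmap_compA.
Defined.

(* X^K, with n-simplices the maps Delta^n x K -> X. *)
Definition sset_exp (X K : sset) : sset.
Proof.
exists (fun n => sset_hom (sset_prod (std_simplex n) K) X) (@sset_exp_act X K).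
- by move=> n phi; apply: sset_hom_ext => m [h x] /=; rewrite ordmap_comp1m.
- by move=> l m n g f phi; apply: sset_hom_ext => k [h x] /=; rewrite ordmap_compA.
Defined.

Definition sset_eval (X K : sset) (v : K 0) : sset_hom (sset_exp X K) X.
Proof.
exists (fun n (phi : sset_exp X K n) => phi n (ordmap_id n.+1, degen v n)).
move=> m n f phi /=; rewrite -sset_nat /=; congr (phi _ (_, _)).
  by rewrite ordmap_comp1m ordmap_compm1.
by rewrite /degen -act_comp; congr act; apply: ordmap_ext => i;
  rewrite ordmap_compE !mk_ordmapE.
Defined.

Section Fiber.
Variables (X Y : sset) (p : sset_hom X Y) (y : Y 0).

Lemma fiber_act m n (f : simp m n) (x : X n) :
  p n x = degen y n -> p m (act f x) = degen y m.
Proof.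
move=> px; rewrite sset_nat px /degen -act_comp; congr act.
by apply: ordmap_ext => i; rewrite ordmap_compE !mk_ordmapE.
Qed.

Definition fiber : sset := sub_sset (P := fun n x => p n x = degen y n) fiber_act.
Definition fiber_incl : sset_hom fiber X := sub_incl fiber_act.
End Fiber.

Notation "{ 'monoid_hom' A -> B }" := (UMagmaMorphism.type A B)
  (at level 0, A at level 98, B at level 99, format "{ 'monoid_hom'  A  ->  B }")
  : type_scope.

Lemma monoid_hom_ext (A B : monoidType) (f g : {monoid_hom A -> B}) : f =1 g -> f = g.
Proof.
case: f g => [f [[f1] [fM]]] [g [[g1] [gM]]] /= /funext fg.
by case: _ / fg g1 gM => g1 gM; rewrite (Prop_irrelevance f1 g1) (Prop_irrelevance fM gM).
Qed.

Section Coproduct.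
Variables (I : Type) (A : I -> monoidType).

Definition coprod_word := seq {i : I & A i}.
HB.instance Definition _ := gen_eqMixin coprod_word.
HB.instance Definition _ := gen_choiceMixin coprod_word.

Definition letter i (a : A i) : {i : I & A i} := Tagged (fun j => A j : Type) a.

(* The congruence on words generated by (i,1) ~ empty word and (i,a)(i,b) ~ (i,ab). *)
Inductive coprod_eq : coprod_word -> coprod_word -> Prop :=
| coprod_eq1 u v i : coprod_eq (u ++ letter (1 : A i) :: v) (u ++ v)
| coprod_eqM u v i (a b : A i) :
    coprod_eq (u ++ letter a :: letter b :: v) (u ++ letter (a * b) :: v)
| coprod_eq_refl u : coprod_eq u u
| coprod_eq_sym u v : coprod_eq u v -> coprod_eq v u
| coprod_eq_trans u v w : coprod_eq u v -> coprod_eq v w -> coprod_eq u w.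

Definition coprod_eqb (u v : coprod_word) : bool := `[< coprod_eq u v >].

Lemma coprod_eqb_refl : reflexive coprod_eqb.
Proof. by move=> u; apply/asboolP/coprod_eq_refl. Qed.

Lemma coprod_eqb_sym : symmetric coprod_eqb.
Proof. by move=> u v; apply/asboolP/asboolP; apply: coprod_eq_sym. Qed.

Lemma coprod_eqb_trans : transitive coprod_eqb.
Proof. by move=> v u w /asboolP uv /asboolP vw; apply/asboolP/(coprod_eq_trans uv vw). Qed.

Canonical coprod_equiv := EquivRel coprod_eqb coprod_eqb_refl coprod_eqb_sym coprod_eqb_trans.

Definition coprod := {eq_quot coprod_equiv}.
HB.instance Definition _ := Choice.on coprod.

Definition coprod_class (u : coprod_word) : coprod := \pi_({eq_quot coprod_equiv}) u.
Definition coprod_repr (x : coprod) : coprod_word := @repr _ {eq_quot coprod_equiv} x.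

Lemma coprod_reprK x : coprod_class (coprod_repr x) = x.
Proof. exact: reprK. Qed.

Lemma coprod_classP u v : coprod_class u = coprod_class v <-> coprod_eq u v.
Proof. by split=> [/eqmodP/asboolP|/asboolP uv]; last exact/eqmodP. Qed.

Lemma coprod_repr_class u : coprod_eq (coprod_repr (coprod_class u)) u.
Proof. by apply/coprod_classP; rewrite coprod_reprK. Qed.

Lemma coprod_eq_cat2 u v w : coprod_eq u v -> coprod_eq (w ++ u) (w ++ v).
Proof.
elim=> {u v} [u v i|u v i a b|u|u v _|u v t _ uv _ vt].
- by rewrite !catA; apply: coprod_eq1.
- by rewrite !catA; apply: coprod_eqM.
- exact: coprod_eq_refl.
- exact: coprod_eq_sym.
- exact: coprod_eq_trans vt.
Qed.

Lemma coprod_eq_cat1 u v w : coprod_eq u v -> coprod_eq (u ++ w) (v ++ w).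
Proof.
elim=> {u v} [u v i|u v i a b|u|u v _|u v t _ uv _ vt].
- by rewrite -!catA; apply: coprod_eq1.
- by rewrite -!catA; apply: coprod_eqM.
- exact: coprod_eq_refl.
- exact: coprod_eq_sym.
- exact: coprod_eq_trans vt.
Qed.

Definition coprod_mul (x y : coprod) : coprod :=
  coprod_class (coprod_repr x ++ coprod_repr y).

Lemma coprod_mulE u v :
  coprod_mul (coprod_class u) (coprod_class v) = coprod_class (u ++ v).
Proof.
apply/coprod_classP; apply: (@coprod_eq_trans _ (u ++ coprod_repr (coprod_class v))).
  exact/coprod_eq_cat1/coprod_repr_class.
exact/coprod_eq_cat2/coprod_repr_class.
Qed.

Fact coprod_mulA : associative coprod_mul.
Proof.
move=> x y z; rewrite -(coprod_reprK x) -(coprod_reprK y) -(coprod_reprK z).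
by rewrite !coprod_mulE catA.
Qed.

Fact coprod_mul1 : left_id (coprod_class [::]) coprod_mul.
Proof. by move=> x; rewrite -(coprod_reprK x) coprod_mulE. Qed.

Fact coprod_mulr1 : right_id (coprod_class [::]) coprod_mul.
Proof. by move=> x; rewrite -(coprod_reprK x) coprod_mulE cats0. Qed.

HB.instance Definition _ := isMonoid.Build coprod coprod_mulA coprod_mul1 coprod_mulr1.

Lemma coprod_class_cat u v : coprod_class (u ++ v) = coprod_class u * coprod_class v.
Proof. by rewrite -coprod_mulE. Qed.

Definition coprod_in_fun i (a : A i) : coprod := coprod_class [:: letter a].

Fact coprod_in_morph i : monoid_morphism (@coprod_in_fun i).
Proof.
split=> [|a b].
  by apply/coprod_classP; apply: (@coprod_eq1 [::] [::]).
rewrite /coprod_in_fun -coprod_class_cat; apply/coprod_classP/coprod_eq_sym.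
exact: (@coprod_eqM [::] [::]).
Qed.

HB.instance Definition _ i :=
  isUMagmaMorphism.Build (A i) coprod (@coprod_in_fun i) (coprod_in_morph i).
Definition coprod_in i : {monoid_hom A i -> coprod} := @coprod_in_fun i.

Section Desc.
Variables (B : monoidType) (h : forall i, {monoid_hom A i -> B}).

Definition word_prod (u : coprod_word) : B := \prod_(p <- u) h (tag p) (tagged p).

Lemma word_prod_eq u v : coprod_eq u v -> word_prod u = word_prod v.
Proof.
elim=> // {u v} [u v i|u v i a b|u v t _ -> //];
  by rewrite /word_prod !big_cat !big_cons /= ?gmulf1 ?mul1g ?gmulfM ?mulgA.
Qed.

Definition coprod_desc_fun (x : coprod) : B := word_prod (coprod_repr x).

Lemma coprod_desc_class u : coprod_desc_fun (coprod_class u) = word_prod u.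
Proof. exact/word_prod_eq/coprod_repr_class. Qed.

Fact coprod_desc_morph : monoid_morphism coprod_desc_fun.
Proof.
split=> [|x y]; first by rewrite coprod_desc_class /word_prod big_nil.
by rewrite -(coprod_reprK x) -(coprod_reprK y) -coprod_class_cat !coprod_desc_class
  /word_prod big_cat.
Qed.

HB.instance Definition _ :=
  isUMagmaMorphism.Build coprod B coprod_desc_fun coprod_desc_morph.
Definition coprod_desc : {monoid_hom coprod -> B} := coprod_desc_fun.

Lemma coprod_desc_in i (a : A i) : coprod_desc (coprod_in i a) = h i a.
Proof. by rewrite [LHS]coprod_desc_class /word_prod big_seq1. Qed.
End Desc.

Lemma coprod_hom_eq (B : monoidType) (f g : {monoid_hom coprod -> B}) :
  (forall i (a : A i), f (coprod_in i a) = g (coprod_in i a)) -> f =1 g.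
Proof.
move=> fg x; rewrite -(coprod_reprK x); elim: (coprod_repr x) => [|[i a] u IHu].
  by rewrite [coprod_class _](_ : _ = 1) // !gmulf1.
by rewrite -cat1s coprod_class_cat !gmulfM IHu; congr (_ * _); apply: fg.
Qed.
End Coproduct.

Record smon := SMon {
  smon_ob :> nat -> monoidType;
  smon_act : forall m n, simp m n -> {monoid_hom smon_ob n -> smon_ob m};
  smon_act_id : forall n (x : smon_ob n), smon_act (ordmap_id n.+1) x = x;
  smon_act_comp : forall l m n (g : simp m n) (f : simp l m) (x : smon_ob n),
    smon_act (ordmap_comp g f) x = smon_act f (smon_act g x)
}.

Definition usset (M : smon) : sset :=
  SSet (act := fun m n f x => smon_act M f x) (@smon_act_id M) (@smon_act_comp M).

Record smon_hom (M N : smon) := SMonHom {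
  smon_fun :> forall n, {monoid_hom M n -> N n};
  smon_nat : forall m n (f : simp m n) (x : M n),
    smon_fun m (smon_act M f x) = smon_act N f (smon_fun n x)
}.

Lemma smon_hom_ext (M N : smon) (f g : smon_hom M N) :
  (forall n (x : M n), f n x = g n x) -> f = g.
Proof.
case: f g => [f fn] [g gn] /= fg.
have {}fg : f = g by apply: functional_extensionality_dep => n; apply/monoid_hom_ext/fg.
by case: _ / fg gn => gn; rewrite (Prop_irrelevance fn gn).
Qed.

(* S (x) M, whose monoid of n-simplices is the coproduct of copies of M_n indexed by
   S_n. *)
Section Tensor.
Variables (S : sset) (M : smon).

Definition tensor_ob n : monoidType := coprod (fun _ : S n => M n).

Definition tensor_in n (s : S n) : {monoid_hom M n -> tensor_ob n} :=
  coprod_in (fun _ : S n => M n) s.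

Definition tensor_act m n (f : simp m n) : {monoid_hom tensor_ob n -> tensor_ob m} :=
  coprod_desc (fun s : S n => tensor_in (act f s) \o smon_act M f).

Lemma tensor_act_in m n (f : simp m n) (s : S n) (x : M n) :
  tensor_act f (tensor_in s x) = tensor_in (act f s) (smon_act M f x).
Proof. exact: coprod_desc_in. Qed.

Definition tensor : smon.
Proof.
exists tensor_ob tensor_act.
- move=> n; apply: (@coprod_hom_eq _ _ _ (tensor_act _) idfun) => s x.
  by rewrite tensor_act_in act_id smon_act_id.
- move=> l m n g f.
  apply: (@coprod_hom_eq _ _ _ (tensor_act _) (tensor_act f \o tensor_act g)) => s x.
  by rewrite /= !tensor_act_in act_comp smon_act_comp.
Defined.
End Tensor.

Section TensorMap.
Variables (S T : sset) (M : smon) (u : sset_hom S T).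

Definition tensor_map_ob n : {monoid_hom tensor S M n -> tensor T M n} :=
  coprod_desc (fun s : S n => tensor_in M (u n s)).

Lemma tensor_map_in n (s : S n) (x : M n) :
  tensor_map_ob n (tensor_in M s x) = tensor_in M (u n s) x.
Proof. exact: coprod_desc_in. Qed.

Definition tensor_map : smon_hom (tensor S M) (tensor T M).
Proof.
exists tensor_map_ob => m n f.
apply: (@coprod_hom_eq _ _ _ (tensor_map_ob m \o tensor_act S M f)
                             (tensor_act T M f \o tensor_map_ob n)) => s x /=.
by rewrite [tensor_act _ _ _ _]tensor_act_in !tensor_map_in tensor_act_in sset_nat.
Defined.
End TensorMap.

Definition smon_comp (L M N : smon) (g : smon_hom M N) (f : smon_hom L M) : smon_hom L N.
Proof.
exists (fun n => g n \o f n).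
by move=> m n a x /=; rewrite !smon_nat.
Defined.

Lemma tensor_hom_ext (S : sset) (M N : smon) (f g : smon_hom (tensor S M) N) :
  (forall n (s : S n) (x : M n), f n (tensor_in M s x) = g n (tensor_in M s x)) -> f = g.
Proof.
by move=> fg; apply: smon_hom_ext => n; apply: (@coprod_hom_eq _ _ _ (f n) (g n)) => s x;
  apply: fg.
Qed.

Section MapSpace.
Variables M N : smon.

Definition smon_map_act m n (f : simp m n)
    (phi : smon_hom (tensor (std_simplex n) M) N) : smon_hom (tensor (std_simplex m) M) N :=
  smon_comp phi (tensor_map M (simplex_map f)).

Lemma smon_map_actE m n (f : simp m n) phi l (s : simp l m) (x : M l) :
  smon_map_act f phi l (tensor_in (S := std_simplex m) M s x)
    = phi l (tensor_in (S := std_simplex n) M (ordmap_comp f s) x).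
Proof. exact: (congr1 (phi l) (tensor_map_in (simplex_map f) s x)). Qed.

(* Map(M,N), with n-simplices the morphisms Delta^n (x) M -> N. *)
Definition smon_map : sset.
Proof.
exists (fun n => smon_hom (tensor (std_simplex n) M) N) smon_map_act.
- by move=> n phi; apply: tensor_hom_ext => m s x; rewrite smon_map_actE ordmap_comp1m.
- by move=> l m n g f phi; apply: tensor_hom_ext => k s x;
    rewrite !smon_map_actE ordmap_compA.
Defined.
End MapSpace.

(* Restriction Map(M,N) -> N^K along a map of simplicial sets u : K -> M. *)
Section Restriction.
Variables (M N : smon) (K : sset) (u : sset_hom K (usset M)).

Definition smon_restr_ob n (phi : smon_map M N n) : sset_exp (usset N) K n.
Proof.
exists (fun m (p : sset_prod (std_simplex n) K m) => phi m (tensor_in M p.1 (u m p.2))).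
move=> l m f [g x].
transitivity (phi l (tensor_act (std_simplex n) M f (tensor_in M g (u m x)))).
  by rewrite tensor_act_in /= sset_nat.
exact: (smon_nat phi).
Defined.

Definition smon_restr : sset_hom (smon_map M N) (sset_exp (usset N) K).
Proof.
exists smon_restr_ob => m n f phi; apply: sset_hom_ext => l [g x].
exact: smon_map_actE.
Defined.
End Restriction.

Record category := Category {
  cat_ob :> Type;
  hom : cat_ob -> cat_ob -> Type;
  idm : forall a, hom a a;
  compm : forall a b c, hom b c -> hom a b -> hom a c;
  comp1m : forall a b (f : hom a b), compm (idm b) f = f;
  compm1 : forall a b (f : hom a b), compm f (idm a) = f;
  compmA : forall a b c d (h : hom c d) (g : hom b c) (f : hom a b),
    compm h (compm g f) = compm (compm h g) f
}.
Arguments idm {_}.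
Arguments compm {_ a b c}.

(* A morphism together with its source and target: equations between morphisms whose
   sources and targets are only propositionally equal are stated as equations between
   [arr]s. *)
Definition arr (C : category) (a b : C) (f : hom a b) : {ab : C * C & hom ab.1 ab.2} :=
  existT (fun ab : C * C => hom ab.1 ab.2) (a, b) f.

Record functor (C D : category) := Functor {
  fun_ob :> C -> D;
  fun_hom : forall a b, hom a b -> hom (fun_ob a) (fun_ob b);
  fun_id : forall a, fun_hom (idm a) = idm (fun_ob a);
  fun_comp : forall a b c (g : hom b c) (f : hom a b),
    fun_hom (compm g f) = compm (fun_hom g) (fun_hom f)
}.

Lemma functor_ext (C D : category) (F G : functor C D) :
  (forall a b (f : hom a b), arr (fun_hom F f) = arr (fun_hom G f)) -> F = G.
Proof.
case: F G => [F Fh F1 Fc] [G Gh G1 Gc] /= FG.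
have FGob : F = G by apply: funext => a; have := congr1 (fun x => (tag x).1) (FG _ _ (idm a)).
case: _ / FGob Gh G1 Gc FG => Gh G1 Gc FG.
have FGhom : Fh = Gh.
  do 2![apply: functional_extensionality_dep => ?]; apply: funext => f.
  have := projT2_eq (FG _ _ f) => /=.
  by move: (projT1_eq _) => /= p; rewrite (Prop_irrelevance p erefl).
case: _ / FGhom G1 Gc {FG} => G1 Gc.
by rewrite (Prop_irrelevance F1 G1) (Prop_irrelevance Fc Gc).
Qed.

Definition functor_compose (B C D : category) (G : functor C D) (F : functor B C) :
  functor B D.
Proof.
exists (fun a => G (F a)) (fun a b f => fun_hom G (fun_hom F f)).
- by move=> a; rewrite !fun_id.
- by move=> a b c g f; rewrite !fun_comp.
Defined.

(* The poset {0 < ... < n}, as a category. *)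
Definition ord_cat (n : nat) : category.
Proof.
exists 'I_n.+1 (fun i j => i <= j) (fun i => leqnn i) (fun i j k jk ij => leq_trans ij jk).
all: by move=> *; apply: bool_irrelevance.
Defined.

Definition ord_functor m n (f : simp m n) : functor (ord_cat m) (ord_cat n).
Proof.
exists (f : ord_cat m -> ord_cat n) (ordmap_mono f).
all: by move=> *; apply: bool_irrelevance.
Defined.

Definition nerve_ob (C : category) (n : nat) := functor (ord_cat n) C.

Definition nerve_act (C : category) m n (f : simp m n) (F : nerve_ob C n) : nerve_ob C m :=
  functor_compose F (ord_functor f).

Lemma nerve_arr_irr (C : category) n (F : nerve_ob C n) (i j i' j' : ord_cat n)
    (ij : hom i j) (ij' : hom i' j') :
  i = i' -> j = j' -> arr (fun_hom F ij) = arr (fun_hom F ij').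
Proof. by move=> ii' jj'; subst i' j'; rewrite (bool_irrelevance ij ij'). Qed.

Lemma nerve_act_id (C : category) n (F : nerve_ob C n) : nerve_act (ordmap_id n.+1) F = F.
Proof.
apply: functor_ext => i j ij.
exact: (nerve_arr_irr F (fun_hom (ord_functor (ordmap_id n.+1)) ij) ij
         (ordmap_idE _) (ordmap_idE _)).
Qed.

Lemma nerve_act_comp (C : category) l m n (g : simp m n) (f : simp l m) (F : nerve_ob C n) :
  nerve_act (ordmap_comp g f) F = nerve_act f (nerve_act g F).
Proof.
apply: functor_ext => i j ij.
exact: (nerve_arr_irr F (fun_hom (ord_functor (ordmap_comp g f)) ij)
         (fun_hom (ord_functor g) (fun_hom (ord_functor f) ij))
         (ordmap_compE _ _ _) (ordmap_compE _ _ _)).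
Qed.

(* The associativity and unit laws on objects are those on morphisms, for identity
   morphisms. *)
Record strict_monoidal := StrictMonoidal {
  smc_cat :> category;
  tens : smc_cat -> smc_cat -> smc_cat;
  tensm : forall a b a' b' : smc_cat,
    hom a b -> hom a' b' -> hom (tens a a') (tens b b');
  tens_unit : smc_cat;
  tensm_id : forall a b, tensm (idm a) (idm b) = idm (tens a b);
  tensm_comp : forall a b c a' b' c' (g : hom b c) (f : hom a b) (g' : hom b' c')
      (f' : hom a' b'),
    tensm (compm g f) (compm g' f') = compm (tensm g g') (tensm f f');
  tensmA : forall a b a' b' a'' b'' (f : hom a b) (g : hom a' b') (h : hom a'' b''),
    arr (tensm f (tensm g h)) = arr (tensm (tensm f g) h);
  tensm1 : forall a b (f : hom a b), arr (tensm (idm tens_unit) f) = arr f;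
  tensm1r : forall a b (f : hom a b), arr (tensm f (idm tens_unit)) = arr f
}.

Section NerveMonoid.
Variable C : strict_monoidal.

(* The simplicial monoid N(C), with levelwise multiplication N(tens). *)
Definition nerve_mul n (F G : nerve_ob C n) : nerve_ob C n.
Proof.
exists (fun i => tens (F i) (G i)) (fun i j ij => tensm (fun_hom F ij) (fun_hom G ij)).
- by move=> i; rewrite !fun_id tensm_id.
- by move=> i j k jk ij; rewrite !fun_comp tensm_comp.
Defined.

Definition nerve_one n : nerve_ob C n.
Proof.
exists (fun _ => tens_unit C) (fun _ _ _ => idm (tens_unit C)) => //.
by move=> *; rewrite comp1m.
Defined.

Fact nerve_mulA n : associative (@nerve_mul n).
Proof. by move=> F G H; apply: functor_ext => i j ij; apply: tensmA. Qed.

Fact nerve_mul1 n : left_id (nerve_one n) (@nerve_mul n).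
Proof. by move=> F; apply: functor_ext => i j ij; apply: tensm1. Qed.

Fact nerve_mulr1 n : right_id (nerve_one n) (@nerve_mul n).
Proof. by move=> F; apply: functor_ext => i j ij; apply: tensm1r. Qed.

Definition nerve_mon_ob n := nerve_ob C n.
HB.instance Definition _ n := gen_eqMixin (nerve_mon_ob n).
HB.instance Definition _ n := gen_choiceMixin (nerve_mon_ob n).
HB.instance Definition _ n :=
  isMonoid.Build (nerve_mon_ob n) (@nerve_mulA n) (@nerve_mul1 n) (@nerve_mulr1 n).

Definition nerve_mon_act m n (f : simp m n) (F : nerve_mon_ob n) : nerve_mon_ob m :=
  nerve_act f F.

Fact nerve_mon_act_morph m n (f : simp m n) : monoid_morphism (nerve_mon_act f).
Proof. by split=> [|F G]; apply: functor_ext. Qed.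

HB.instance Definition _ m n (f : simp m n) :=
  isUMagmaMorphism.Build (nerve_mon_ob n) (nerve_mon_ob m) (nerve_mon_act f)
    (nerve_mon_act_morph f).

Definition nerve_mon : smon :=
  SMon (smon_ob := nerve_mon_ob) (smon_act := fun m n f => nerve_mon_act f)
    (@nerve_act_id C) (@nerve_act_comp C).
End NerveMonoid.

(* The object [n] is represented by its cardinal n+1; the join of objects is addn. *)
Definition Delta_plus_cat : category :=
  Category ordmap_comp1m ordmap_compm1 ordmap_compA.

Section Join.
Variables (k l k' l' : nat) (f : ordmap k l) (f' : ordmap k' l').

Definition join_fun (i : 'I_(k + k')) : 'I_(l + l') :=
  match split i with inl j => lshift l' (f j) | inr j => rshift l (f' j) end.

Lemma join_fun_mono (i j : 'I_(k + k')) : i <= j -> join_fun i <= join_fun j.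
Proof.
rewrite /join_fun; case: (splitP i) => i' ->; case: (splitP j) => j' -> //=.
- exact: ordmap_mono.
- by move=> _; rewrite (leq_trans (ltnW (ltn_ord _))) ?leq_addr.
- by move=> /leq_ltn_trans/(_ (ltn_ord j')); rewrite ltnNge leq_addr.
- by rewrite !leq_add2l; apply: ordmap_mono.
Qed.

Definition join : ordmap (k + k') (l + l') := mk_ordmap join_fun_mono.

Lemma join_lshift (i : 'I_k) : join (lshift k' i) = lshift l' (f i).
Proof. by rewrite mk_ordmapE /join_fun (unsplitK (inl i)). Qed.

Lemma join_rshift (i : 'I_k') : join (rshift k i) = rshift l (f' i).
Proof. by rewrite mk_ordmapE /join_fun (unsplitK (inr i)). Qed.
End Join.

Lemma ordmap_arr_eq k l k' l' (f : ordmap k l) (f' : ordmap k' l') :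
  k = k' -> l = l' ->
  (forall (i : 'I_k) (i' : 'I_k'), i = i' :> nat -> f i = f' i' :> nat) ->
  arr (f : @hom Delta_plus_cat k l) = arr (f' : @hom Delta_plus_cat k' l').
Proof.
move=> kk' ll'; subst k' l' => ff'; congr arr.
by apply: ordmap_ext => i; apply/val_inj/ff'.
Qed.

Lemma join_val k l k' l' (f : ordmap k l) (f' : ordmap k' l') (i : 'I_(k + k')) :
  join f f' i = (match split i with inl j => f j : nat | inr j => l + f' j end) :> nat.
Proof. by rewrite mk_ordmapE /join_fun; case: (split i). Qed.

Fact join_id k l : join (ordmap_id k) (ordmap_id l) = ordmap_id (k + l).
Proof.
apply: ordmap_ext => i; apply: val_inj; rewrite ordmap_idE /= join_val.
by case: splitP => j ->; rewrite ordmap_idE.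
Qed.

Fact join_comp k l m k' l' m' (g : ordmap l m) (f : ordmap k l)
    (g' : ordmap l' m') (f' : ordmap k' l') :
  join (ordmap_comp g f) (ordmap_comp g' f') = ordmap_comp (join g g') (join f f').
Proof.
apply: ordmap_ext => i; rewrite ordmap_compE; case: (split_ordP i) => j ->.
  by rewrite !join_lshift ordmap_compE.
by rewrite !join_rshift ordmap_compE.
Qed.

Fact joinA k l k' l' k'' l'' (f : ordmap k l) (g : ordmap k' l') (h : ordmap k'' l'') :
  arr (join f (join g h) : @hom Delta_plus_cat _ _)
    = arr (join (join f g) h : @hom Delta_plus_cat _ _).
Proof.
apply: ordmap_arr_eq => [||i i' ii']; rewrite ?addnA //.
case: (split_ordP i) ii' => j -> /=.
  move=> ii'; have -> : i' = lshift k'' (lshift k' j) by apply: val_inj.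
  by rewrite !join_lshift.
case: (split_ordP j) => j' -> /= ii'.
  have -> : i' = lshift k'' (rshift k j') by apply: val_inj.
  by rewrite join_rshift !join_lshift join_rshift.
have -> : i' = rshift (k + k') j' by apply: val_inj; rewrite /= -ii' addnA.
by rewrite !join_rshift /= addnA.
Qed.

Fact join1 k l (f : ordmap k l) :
  arr (join (ordmap_id 0) f : @hom Delta_plus_cat _ _) = arr (f : @hom Delta_plus_cat _ _).
Proof.
apply: ordmap_arr_eq => // i i' ii'.
have -> : i = rshift 0 i' by apply: val_inj.
by rewrite join_rshift.
Qed.

Fact joinr1 k l (f : ordmap k l) :
  arr (join f (ordmap_id 0) : @hom Delta_plus_cat _ _) = arr (f : @hom Delta_plus_cat _ _).
Proof.
apply: ordmap_arr_eq => [||i i' ii']; rewrite ?addn0 //.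
have -> : i = lshift 0 i' by apply: val_inj.
by rewrite join_lshift.
Qed.

Definition Delta_plus : strict_monoidal :=
  StrictMonoidal (smc_cat := Delta_plus_cat) (tens := addn) (tens_unit := 0%N)
    join_id join_comp joinA join1 joinr1.

Definition NDelta_plus : smon := nerve_mon Delta_plus.

(* The 1-simplex [-1] -> [0] of N(Delta_+): the functor sending i in {0 < 1} to the
   ordinal [i-1], and i <= j to the inclusion. *)
Definition unit_arrow : usset NDelta_plus 1%N.
Proof.
exists (fun i : 'I_2 => i : nat) (fun i j ij => ordmap_widen ij).
- by move=> i; apply: ordmap_ext => x; apply: val_inj; rewrite !mk_ordmapE.
- move=> i j k jk ij; apply: ordmap_ext => x.
  rewrite [RHS](ordmap_compE (ordmap_widen jk) (ordmap_widen ij)).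
  by apply: val_inj; rewrite !mk_ordmapE.
Defined.

Definition classify (X : sset) n (x : X n) : sset_hom (std_simplex n) X.
Proof.
exists (fun m (f : simp m n) => act f x).
by move=> l m g f; rewrite -act_comp.
Defined.

Definition strict_monoidal_infty_category (E : smon) : Prop := quasi_category (usset E).

Section InftyMonoids.
Variable E : smon.

Definition unit_ob : usset E 0 := (1 : E 0).

Definition eval0 : sset_hom (sset_exp (usset E) (std_simplex 1)) (usset E) :=
  sset_eval (usset E) (vertex (ord0 : 'I_2)).

(* The fat slice E^{1/}. A vertex is a map Delta^0 x Delta^1 -> E, i.e. an edge
   eta : 1 -> x of E. *)
Definition coaug : sset := fiber eval0 unit_ob.

Definition mon_infty : sset := smon_map NDelta_plus E.

Definition forget_arrow : sset_hom mon_infty (sset_exp (usset E) (std_simplex 1)) :=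
  smon_restr E (classify unit_arrow).

Lemma forget_arrow0 n (phi : mon_infty n) : eval0 n (forget_arrow n phi) = degen unit_ob n.
Proof.
have -> : degen unit_ob n = (1 : E n) := @gmulf1 _ _ (smon_act E (ordmap_const n.+1 ord0)).
have unit0 : classify unit_arrow n (degen (vertex (ord0 : 'I_2)) n) = (1 : NDelta_plus n).
  have v0 (i : 'I_n.+1) : degen (vertex (ord0 : 'I_2)) n i = 0%N :> nat.
    rewrite (ordmap_compE (vertex (ord0 : 'I_2)) (ordmap_const n.+1 ord0)).
    by rewrite mk_ordmapE.
  apply: functor_ext => i j ij; apply: ordmap_arr_eq => [||x]; [exact: v0|exact: v0|].
  by have := ltn_ord x; rewrite [X in _ < X]v0.
set v := degen (vertex _) n in unit0.
transitivity (phi n (tensor_in (S := std_simplex n) NDelta_plus (ordmap_id n.+1)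
                       (classify unit_arrow n v))); first by [].
by rewrite unit0 !gmulf1.
Qed.

Definition forget : sset_hom mon_infty coaug.
Proof.
exists (fun n phi => exist _ (forget_arrow n phi) (forget_arrow0 phi)).
by move=> m n f phi; apply: eq_exist; rewrite sset_nat.
Defined.

Definition mon_infty_on (t : coaug 0) : sset := fiber forget t.
End InftyMonoids.

(* Main.v *)
Require Import Defs.
From HB Require Import structures.
From mathcomp Require Import all_boot boolp classical_sets zify.

Set Implicit Arguments.
Unset Strict Implicit.
Unset Printing Implicit Defensive.
Local Open Scope group_scope.

(** Write N for the nerve of the category of finite ordinals. A chain of ordinals
    a_0 -> ... -> a_n splits uniquely as the join of its fibers over the points of a_n, so the
    [n]-simplices of N form the free monoid on the chains with a_n = [0] ([split_first],
    [mul_chain_inj]). Operators preserving the last vertex preserve these generators, while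
    the last face of a generator is a word in generators. Hence N, and likewise its tensor
    with a simplex, is a free simplicial monoid with a basis closed under degeneracies
    ([tensor_basis]), and a morphism out of it can be built by attaching one basis cell at a
    time: the new cell may have any value whose faces are the prescribed words
    ([attach_cell], [attach_horn]).

    Everything follows from one extension statement ([forget_sphere_extension]): let H be a
    [k]-simplex of coaugmented objects with last vertex the terminal one, and let b be a map
    from the boundary of the [k]-simplex to monoids lying over the boundary of H. Then b
    extends to a [k]-simplex of monoids lying over H. With H constant, this says that the
    space of monoid structures on t is contractible, hence inhabited and Kan. For the
    terminality of a monoid over t, the simplex H is itself obtained from the terminality
    of t.

    To prove the extension statement, the cells (alpha, a_0 -> ... -> a_n = [0]) that are not
    prescribed are paired off. If the first vertex with nonempty ordinal is (i, a_p), a cell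
    without the vertex (i, empty) just before it is paired with the cell in which this
    vertex has been inserted. Attaching such a pair amounts to filling a horn, at the
    position p of the insertion. A Zorn argument ([pairing_extension]) reduces the problem
    to finding fillers, and an induction on the number of vertices with nonempty ordinal
    shows that the other faces of each horn are attached before. If p > 0 the horn is inner.

    If p = 0, the horn is the outer horn at the first vertex (0, empty), whose value is the
    unit object, and terminality has to be used ([horn_under_unit]). The cells attached
    before contain the prism over the boundary of the missing face, that is, the chains
    (alpha_0, empty), ..., (alpha_j, empty), (alpha_j, a_j), ..., and also the cone on this
    prism with apex (0, empty). The prism is a sphere of coaugmented objects; its last
    vertex is the edge from (k, empty) to (k, [0]), whose value is t. So the sphere can be
    filled, and then inner horns extend the cone from the boundary of the prism to the whole
    prism; the cone on the top of the prism is the required filler. *)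

(** * Cofaces, codegeneracies and sections of monotone maps *)

Lemma lift_mono n (i : 'I_n.+1) (x y : 'I_n) : x <= y -> lift i x <= lift i y.
Proof. by rewrite /= /bump; lia. Qed.

Definition coface n (i : 'I_n.+1) : ordmap n n.+1 := mk_ordmap (@lift_mono n i).

Lemma cofaceE n (i : 'I_n.+1) x : coface i x = lift i x.
Proof. exact: mk_ordmapE. Qed.

Lemma codegen_lt n (p : 'I_n) (x : 'I_n.+1) : unbump p x < n.
Proof. by case: p x => p ltp [x ltx] /=; rewrite /unbump; lia. Qed.

Lemma codegen_mono n (p : 'I_n) (x y : 'I_n.+1) :
  x <= y -> Ordinal (codegen_lt p x) <= Ordinal (codegen_lt p y).
Proof. by rewrite /= /unbump; lia. Qed.

Definition codegen n (p : 'I_n) : ordmap n.+1 n := mk_ordmap (@codegen_mono n p).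

Lemma codegenE n (p : 'I_n) x : codegen p x = unbump p x :> nat.
Proof. by rewrite mk_ordmapE. Qed.

Lemma codegenK n (p : 'I_n) (i : 'I_n.+1) :
  i = p :> nat \/ i = p.+1 :> nat -> ordmap_comp (codegen p) (coface i) = ordmap_id n.
Proof.
move=> ip; apply: ordmap_ext => x; apply: ord_inj.
by rewrite ordmap_compE codegenE cofaceE ordmap_idE /= /bump /unbump; lia.
Qed.

Lemma coface_factor m n (f : ordmap m n.+1) (i : 'I_n.+1) :
  (forall x, f x != i) -> exists g : ordmap m n, f = ordmap_comp (coface i) g.
Proof.
move=> fi.
have ex x : {y | f x = lift i y}.
  by case: (unliftP i (f x)) => [y ->|fx]; [exists y | move: (fi x); rewrite fx eqxx].
pose g x := sval (ex x).
have gE x : f x = lift i (g x) := svalP (ex x).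
have g_mono (x y : 'I_m) : x <= y -> g x <= g y.
  by move=> /(ordmap_mono f); rewrite !gE /= /bump; lia.
exists (mk_ordmap g_mono).
by apply: ordmap_ext => x; rewrite ordmap_compE cofaceE mk_ordmapE.
Qed.

Lemma coface_in_horn m n (k i : 'I_n.+2) (g : simp m n) :
  i != k -> in_horn k (ordmap_comp (coface i) g).
Proof.
move=> ik; apply/existsP; exists i; rewrite ik; apply/forallP => x.
by rewrite ordmap_compE cofaceE eq_sym neq_lift.
Qed.

Lemma in_hornP m n (k : 'I_n.+2) (f : simp m n.+1) : in_horn k f ->
  exists (i : 'I_n.+2) (g : simp m n), i != k /\ f = ordmap_comp (coface i) g.
Proof.
case/existsP => i /andP[ik /forallP fi].
by have [g ->] := coface_factor fi; exists i, g.
Qed.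

Lemma boundary_coface m n (k : 'I_n.+2) (f : simp m n) :
  in_horn k (ordmap_comp (coface k) f) = in_boundary f.
Proof.
apply/existsP/existsP => [[i /andP[ik /forallP fi]]|[i /forallP fi]].
  have [j ij] : exists j, i = lift k j.
    by case: (unliftP k i) ik => [j ->|->]; [exists j | rewrite eqxx].
  exists j; apply/forallP => x; move: (fi x).
  by rewrite ordmap_compE cofaceE ij (inj_eq lift_inj).
exists (lift k i); rewrite eq_sym neq_lift; apply/forallP => x.
by rewrite ordmap_compE cofaceE (inj_eq lift_inj).
Qed.

Lemma horn_boundary m n (k : 'I_n.+1) (f : std_simplex n m) : in_horn k f -> in_boundary f.
Proof. by case/existsP => i /andP[_ fi]; apply/existsP; exists i. Qed.

Lemma boundary_not_horn m n (k : 'I_n.+2) (f : simp m n.+1) :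
  in_boundary f -> ~~ in_horn k f -> exists g : simp m n, f = ordmap_comp (coface k) g.
Proof.
case/existsP => i /forallP fi /existsPn/(_ i); rewrite negb_and negbK.
case/orP => [/eqP ik|/forallPn [x]]; last by rewrite fi.
by apply: coface_factor; rewrite -ik.
Qed.

Lemma ontoP m n (f : simp m n) : ~~ in_boundary f -> forall y, exists x, f x = y.
Proof.
move=> /existsPn f_onto y; have /forallPn [x] := f_onto y.
by rewrite negbK => /eqP; exists x.
Qed.

Lemma onto_comp l m n (g : simp m n) (f : simp l m) :
  ~~ in_boundary g -> ~~ in_boundary f -> ~~ in_boundary (ordmap_comp g f : simp l n).
Proof.
move=> /ontoP g_onto /ontoP f_onto; apply/existsPn => z; apply/forallPn.
have [y <-] := g_onto z; have [x <-] := f_onto y.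
by exists x; rewrite negbK ordmap_compE.
Qed.

Lemma onto_last m n (f : simp m n) : ~~ in_boundary f -> f ord_max = ord_max.
Proof.
move=> /ontoP/(_ ord_max)[x fx]; apply: ord_inj => /=.
have := ordmap_mono f (leq_ord x : x <= @ord_max m); rewrite fx /=.
by have := leq_ord (f ord_max); lia.
Qed.

Lemma id_onto n : ~~ in_boundary (ordmap_id n.+1 : simp n n).
Proof. by apply/existsPn => i; apply/forallPn; exists i; rewrite negbK ordmap_idE. Qed.

Lemma codegen_onto n (p : 'I_n.+1) : ~~ in_boundary (codegen p : simp n.+1 n).
Proof.
apply/existsPn => i; apply/forallPn; exists (lift (widen_ord (leqnSn _) p) i).
rewrite negbK; apply/eqP/ord_inj; rewrite codegenE /= /bump /unbump.
by lia.
Qed.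

(** Sections of a monotone surjection are automatically monotone, so one can be
    prescribed at any chosen point. *)
Lemma onto_section m n (f : simp m n) (x : 'I_m.+1) : ~~ in_boundary f ->
  exists d : simp n m, ordmap_comp f d = ordmap_id n.+1 /\ d (f x) = x.
Proof.
move=> /ontoP f_onto; pose d y := if y == f x then x else sval (cid (f_onto y)).
have dK y : f (d y) = y.
  by rewrite /d; case: (eqVneq y (f x)) => [->//|_]; exact: (svalP (cid (f_onto y))).
have d_mono (y z : 'I_n.+1) : y <= z -> d y <= d z.
  move=> yz; case: (leqP (d y) (d z)) => // zy.
  have := ordmap_mono f (ltnW zy); rewrite !dK => le_zy.
  have e : y = z by apply: ord_inj; lia.
  by rewrite e ltnn in zy.
exists (mk_ordmap d_mono); split; last by rewrite mk_ordmapE /d eqxx.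
by apply: ordmap_ext => y; rewrite ordmap_compE mk_ordmapE dK ordmap_idE.
Qed.

Lemma injective_endo n (f : simp n n) : injective f -> f = ordmap_id n.+1.
Proof.
move=> f_inj; apply: ordmap_ext => x; rewrite ordmap_idE; apply: ord_inj.
have sorted_f : sorted ltn [seq nat_of_ord (f i) | i <- enum 'I_n.+1].
  rewrite sorted_map; apply: (@sub_sorted _ (fun i j : 'I_n.+1 => i < j)).
    move=> i j /= ij; rewrite ltn_neqAle (ordmap_mono f (ltnW ij)) andbT.
    by apply: contraTneq ij => /ord_inj/f_inj ->; rewrite ltnn.
  by rewrite -(@sorted_map _ _ (@nat_of_ord n.+1) ltn) val_enum_ord iota_ltn_sorted.
have eq_f : [seq nat_of_ord (f i) | i <- enum 'I_n.+1] = [seq nat_of_ord i | i <- enum 'I_n.+1].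
  apply: (irr_sorted_eq ltn_trans ltnn sorted_f).
    by rewrite val_enum_ord iota_ltn_sorted.
  have imf y : exists i, f i = y.
    by have [g _ gK] := injF_bij f_inj; exists (g y); rewrite gK.
  move=> y; apply/mapP/mapP => [[i _ ->]|[i _ ->]].
    by exists (f i); rewrite ?mem_enum.
  by have [j <-] := imf i; exists j; rewrite ?mem_enum.
by move/eq_in_map: eq_f => /(_ x); rewrite mem_enum => ->.
Qed.

Lemma onto_endo n (f : simp n n) : ~~ in_boundary f -> f = ordmap_id n.+1.
Proof.
move=> f_onto; have [d [dK _]] := onto_section ord0 f_onto.
have d1 : d = ordmap_id n.+1.
  apply: injective_endo => i j /(congr1 f).
  by rewrite -!ordmap_compE dK !ordmap_idE.
by rewrite -dK d1 ordmap_compm1.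
Qed.

Lemma noninjective_step m n (f : simp m n) : ~ injective f ->
  exists i j : 'I_m.+1, j = i.+1 :> nat /\ f i = f j.
Proof.
move=> /existsNP [a /existsNP [b /not_implyP [fab ab]]].
wlog lt_ab : a b fab ab / a < b.
  move=> wl; case: (ltngtP a b) => [lt_ab|lt_ba|/ord_inj //]; first exact: (wl a b).
  exact: (wl b a (esym fab) (nesym ab)).
have lt_m : a.+1 < m.+1 by apply: leq_trans (ltn_ord b).
exists a, (Ordinal lt_m); split=> //; apply: ord_inj => /=.
have := ordmap_mono f (leqnSn a : a <= Ordinal lt_m).
have := ordmap_mono f (lt_ab : Ordinal lt_m <= b); rewrite fab.
by lia.
Qed.

(** The idempotents of this form detect degeneracy: a cell is degenerate precisely when it
    is fixed by one of them. *)
Definition collapse n (r : 'I_n.+1) : simp n.+1 n.+1 :=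
  ordmap_comp (coface (lift ord0 r)) (codegen r).

Lemma collapse_lt n (r : 'I_n.+1) (i : 'I_n.+2) :
  collapse r i = (if i == r.+1 :> nat then r : nat else i) :> nat.
Proof.
rewrite ordmap_compE cofaceE /= codegenE /bump /unbump /=.
by case: eqP; lia.
Qed.

Lemma collapse_absorb m n (f : simp m.+1 n) (r : 'I_m.+1) (i j : 'I_m.+2) :
  i = r :> nat -> j = r.+1 :> nat -> f i = f j -> ordmap_comp f (collapse r) = f.
Proof.
move=> ir jr fij; apply: ordmap_ext => x; rewrite ordmap_compE.
have [xr|xr] := eqVneq (x : nat) r.+1.
  have -> : collapse r x = i by apply: ord_inj; rewrite /= collapse_lt xr eqxx ir.
  by rewrite fij; congr (f _); apply: ord_inj; rewrite /= xr jr.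
by congr (f _); apply: ord_inj; rewrite /= collapse_lt (negbTE xr).
Qed.

Lemma endo_collapse n (f : simp n.+1 n.+1) : f <> ordmap_id n.+2 ->
  exists r : 'I_n.+1, ordmap_comp f (collapse r) = f.
Proof.
move=> f1; have /noninjective_step [i [j [ji fij]]] : ~ injective f.
  by move=> /injective_endo.
have lt_i : i < n.+1 by have := ltn_ord j; rewrite ji.
by exists (Ordinal lt_i); apply: (collapse_absorb (i := i) (j := j)).
Qed.

(** * Free simplicial monoids and partial morphisms *)

(** A basis, closed under degeneracies, of a free simplicial monoid: [face f y] is the word
    in generators that represents the image of the generator [y] under [f]. *)
Record basis := Basis {
  cell :> nat -> eqType;
  face : forall m n, simp m n -> cell n -> seq (cell m);
  face_id : forall n (y : cell n), face (ordmap_id n.+1) y = [:: y];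
  face_comp : forall l m n (g : simp m n) (f : simp l m) (y : cell n),
    face (ordmap_comp g f) y = flatten [seq face f z | z <- face g y];
  face_onto : forall m n (f : simp m n) (y : cell n),
    ~~ in_boundary f -> exists z, face f y = [:: z]
}.
Arguments face {b m n}.

Lemma gmulf_prod (A B : monoidType) (f : {monoid_hom A -> B}) I (s : seq I) (F : I -> A) :
  f (\prod_(i <- s) F i) = \prod_(i <- s) f (F i).
Proof. by apply: (big_morph f); [exact: gmulfM | exact: gmulf1]. Qed.

Section Nondegenerate.
Variable Y : basis.

(** If [y] is the degeneracy of [z] along [f] and [d] is a section of [f], then [d] after
    [f] fixes [y]. Phrasing nondegeneracy by fixed endomorphisms avoids mentioning [z] and
    its dimension. *)
Definition nondeg n (y : Y n) : Prop :=
  forall e : simp n n, face e y = [:: y] -> e = ordmap_id n.+1.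

Lemma face_comp1 l m n (g : simp m n) (f : simp l m) (y : Y n) z :
  face g y = [:: z] -> face (ordmap_comp g f) y = face f z.
Proof. by move=> gy; rewrite face_comp gy /= cats0. Qed.

Lemma face_compP l m n (g : simp m n) (f : simp l m) (y : Y n) z :
  z \in face (ordmap_comp g f) y -> exists2 x, x \in face g y & z \in face f x.
Proof. by rewrite face_comp => /flatten_mapP. Qed.

Lemma face_section m n (f : simp m n) (d : simp n m) (z : Y n) y :
  ordmap_comp f d = ordmap_id n.+1 -> face f z = [:: y] -> face d y = [:: z].
Proof. by move=> fd fz; rewrite -(face_comp1 d fz) fd face_id. Qed.

Lemma nondeg_onto m n (f : simp m n) (z : Y n) (y : Y m) :
  ~~ in_boundary f -> face f z = [:: y] -> nondeg y ->
  exists e : m = n, ecast k (Y k) e y = z.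
Proof.
move=> f_onto fz y_nd; have [d [fd _]] := onto_section ord0 f_onto.
have df : ordmap_comp d f = ordmap_id m.+1.
  by apply: y_nd; rewrite (face_comp1 f (face_section fd fz)).
have f_inj : injective f.
  by move=> i j /(congr1 d); rewrite -!ordmap_compE df !ordmap_idE.
have d_inj : injective d.
  by move=> i j /(congr1 f); rewrite -!ordmap_compE fd !ordmap_idE.
have e : m = n.
  have := leq_card f f_inj; have := leq_card d d_inj; rewrite !card_ord; lia.
subst n; exists erefl => /=; move: fz.
by rewrite (onto_endo f_onto) face_id => -[].
Qed.

(** A degenerate cell is fixed by some [collapse r], which factors through the cofaces
    [r] and [r+1]: so two of its faces are available to recover it. *)
Lemma degenerate_face n (y : Y n.+1) : ~ nondeg y ->
  exists r : 'I_n.+1, forall i : 'I_n.+2, i = r :> nat \/ i = r.+1 :> nat ->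
    exists2 z, face (coface i : simp n n.+1) y = [:: z]
             & face (codegen r : simp n.+1 n) z = [:: y].
Proof.
move=> /existsNP [e /not_implyP [ey e1]].
have [r er] := endo_collapse e1; exists r => i ir.
have ry : face (collapse r) y = [:: y].
  by rewrite -(face_comp1 (collapse r) ey) er.
pose c := ordmap_comp (coface i : simp n n.+1) (codegen r : simp n.+1 n).
have cy : face c y = [:: y].
  suff -> : face c y = face (ordmap_comp (collapse r) c) y.
    have -> : ordmap_comp (collapse r) c = collapse r.
      apply: ordmap_ext => x; apply: ord_inj.
      rewrite ordmap_compE [c x]ordmap_compE !collapse_lt cofaceE /= codegenE.
      by rewrite /bump /unbump; do 2![case: eqP]; lia.
    exact: ry.
  by rewrite (face_comp1 c ry).
move: cy; rewrite face_comp => cy.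
(* A word whose degeneracy has length one has length one itself. *)
have size_degen (s : seq (Y n)) :
    size (flatten [seq face (codegen r : simp n.+1 n) z | z <- s]) = size s.
  elim: s => //= z s IH; have [x ->] := face_onto z (codegen_onto r).
  by rewrite /= IH.
have := size_degen (face (coface i : simp n n.+1) y); rewrite cy.
case: (face _ y) cy => [|z [|? ?]] //; rewrite /= cats0 => zy _.
by exists z.
Qed.

Lemma nondeg0 (y : Y 0) : nondeg y.
Proof. by move=> e _; apply: injective_endo => i j _; rewrite [i]ord1 [j]ord1. Qed.

(** Existence half of the Eilenberg-Zilber lemma. *)
Lemma nondeg_factor n (y : Y n) : exists k (f : simp n k) (z : Y k),
  [/\ ~~ in_boundary f, face f z = [:: y] & nondeg z].
Proof.
elim: n y => [|n IH] y.
  by exists 0, (ordmap_id 1), y; rewrite face_id id_onto; split=> //; apply: nondeg0.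
have [y_nd|y_deg] := pselect (nondeg y).
  by exists n.+1, (ordmap_id n.+2), y; rewrite face_id id_onto.
have [r /(_ (lift ord0 r))[|z _ rz]] := degenerate_face y_deg; first by right.
have [k [f [x [f_onto fx x_nd]]]] := IH z.
exists k, (ordmap_comp f (codegen r)), x; split=> //.
  exact: onto_comp (codegen_onto r).
by rewrite (face_comp1 _ fx).
Qed.
End Nondegenerate.

Section Partial.
Variables (Y : basis) (E : smon).

(** A morphism to [E] from the simplicial submonoid generated by [dom]; the values
    outside [dom] carry no information. *)
Record partial_hom := PartialHom {
  dom : forall n, Y n -> Prop;
  pval : forall n, Y n -> E n;
  dom_face : forall m n (f : simp m n) y, dom y -> forall z, z \in face f y -> dom z;
  pval_face : forall m n (f : simp m n) y, dom y ->
    smon_act E f (pval y) = \prod_(z <- face f y) pval z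
}.

Definition ple (P Q : partial_hom) : Prop :=
  forall n (y : Y n), dom P y -> dom Q y /\ pval Q y = pval P y.

Lemma ple_trans P Q R : ple P Q -> ple Q R -> ple P R.
Proof. by move=> PQ QR n y /PQ[/QR[Ry eR] eQ]; split; rewrite ?eR. Qed.

(** The condition that the operator [f] imposes on extending [P] by the value [v] at [y]. *)
Definition faces_in (P : partial_hom) m n (f : simp m n) (y : Y n) (v : E n) : Prop :=
  (forall z, z \in face f y -> dom P z)
  /\ smon_act E f v = \prod_(z <- face f y) pval P z.

Lemma prod_face P m n (f : simp m n) (s : seq (Y n)) : (forall z, z \in s -> dom P z) ->
  smon_act E f (\prod_(z <- s) pval P z)
    = \prod_(z <- flatten [seq face f z | z <- s]) pval P z.
Proof.
rewrite gmulf_prod; elim: s => [|x s IH] sP; first by rewrite !big_nil.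
rewrite /= big_cons big_cat IH => [|z zs]; last by apply: sP; rewrite inE zs orbT.
by rewrite (pval_face f (sP x _)) ?mem_head.
Qed.

Lemma faces_in_comp P l m n (g : simp m n) (f : simp l m) y v :
  faces_in P g y v -> faces_in P (ordmap_comp g f) y v.
Proof.
move=> [gy gv]; split=> [z /face_compP[x /gy xP]|]; first exact: (dom_face xP).
by rewrite smon_act_comp gv face_comp prod_face.
Qed.

Lemma faces_in_le P Q m n (f : simp m n) y v :
  ple P Q -> faces_in P f y v -> faces_in Q f y v.
Proof.
move=> PQ [fy fv]; split=> [z /fy/PQ[]//|]; rewrite fv.
by apply: eq_big_seq => z /fy/PQ[_ ->].
Qed.

Section AttachCell.
Variables (P : partial_hom) (n : nat) (y : Y n) (v : E n).
Hypothesis y_new : ~ dom P y.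
Hypothesis y_boundary : forall m (f : simp m n), in_boundary f -> faces_in P f y v.

Let spans m (z : Y m) (f : simp m n) := ~~ in_boundary f /\ face f y = [:: z].

Let spans_new m (z : Y m) f : spans z f -> ~ dom P z.
Proof.
move=> [f_onto fy] zP; have [d [fd _]] := onto_section ord0 f_onto.
by apply/y_new/(dom_face (f := d) zP); rewrite (face_section fd fy) mem_head.
Qed.

Let spans_inj m (z : Y m) f g : spans z f -> spans z g -> f = g.
Proof.
move=> [f_onto fy] [g_onto gy]; apply: ordmap_ext => x.
have [d [fd dfx]] := onto_section x f_onto.
have gdy : face (ordmap_comp g d) y = [:: y].
  by rewrite (face_comp1 d gy) (face_section fd fy).
have gd_onto : ~~ in_boundary (ordmap_comp g d : simp n n).
  apply/negP => /y_boundary[gdP _].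
  by apply/y_new/gdP; rewrite gdy mem_head.
have := congr1 (fun h => ordmap_fun h (f x)) (onto_endo gd_onto).
by rewrite ordmap_compE ordmap_idE dfx.
Qed.

Let adom m (z : Y m) := dom P z \/ exists f, spans z f.
Let aval m (z : Y m) : E m :=
  if pselect (exists f, spans z f) is left e then smon_act E (sval (cid e)) v
  else pval P z.

Let aval_old m (z : Y m) : dom P z -> aval z = pval P z.
Proof. by rewrite /aval; case: pselect => // -[f fz] /(spans_new fz). Qed.

Let aval_new m (z : Y m) f : spans z f -> aval z = smon_act E f v.
Proof.
rewrite /aval => fz; case: pselect => [e|[]]; last by exists f.
by case: cid => g gz /=; rewrite (spans_inj gz fz).
Qed.

Let afaces l m (f : simp l m) z : adom z ->
  (forall x, x \in face f z -> adom x) /\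
  smon_act E f (aval z) = \prod_(x <- face f z) aval x.
Proof.
case=> [zP|[g gz]].
  split=> [x xz|]; first by left; apply: dom_face xz.
  rewrite aval_old // (pval_face f zP); apply: eq_big_seq => x xz.
  by rewrite aval_old //; apply: dom_face xz.
rewrite (aval_new gz) -smon_act_comp -(face_comp1 f gz.2).
have [gf_bd|gf_onto] := boolP (in_boundary (ordmap_comp g f : simp l n)).
  have [gfP gfv] := y_boundary gf_bd; split=> [x /gfP|]; first by left.
  by rewrite gfv; apply: eq_big_seq => x /gfP /aval_old.
have [x gfx] := face_onto y gf_onto.
have sx : spans x (ordmap_comp g f) by [].
split=> [x'|]; last by rewrite gfx big_seq1 (aval_new sx).
by rewrite gfx inE => /eqP ->; right; exists (ordmap_comp g f).
Qed.

(** The cells of the result outside [dom P] are the [face f y] with [f] onto, and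
    each determines [f]: comparing two such operators along a section of one of
    them yields an endomorphism of [n] fixing [y], which must be onto since the
    boundary of [y] lies in [dom P] and [y] does not. *)
Lemma attach_cell : exists Q : partial_hom, [/\ ple P Q, dom Q y, pval Q y = v &
  forall m (z : Y m), dom Q z ->
    dom P z \/ exists2 f : simp m n, ~~ in_boundary f & face f y = [:: z]].
Proof.
have sy : spans y (ordmap_id n.+1) by rewrite /spans id_onto face_id.
exists (@PartialHom adom aval (fun l m f z zP => (afaces f zP).1)
                        (fun l m f z zP => (afaces f zP).2)); split=> /=.
- by move=> m z zP; split; [left | exact: aval_old].
- by right; exists (ordmap_id n.+1).
- by rewrite (aval_new sy) smon_act_id.
by move=> m z [|[f []]]; [left | right; exists f].
Qed.
End AttachCell.

(** Of the two faces from which a degenerate cell can be recovered, at least one is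
    different from the face opposite to [k]. *)
Lemma degenerate_dom (P : partial_hom) n (k : 'I_n.+2) (y : Y n.+1) :
  (forall m (f : simp m n.+1), in_horn k f -> forall z, z \in face f y -> dom P z) ->
  ~ nondeg y -> dom P y.
Proof.
move=> horn_in /degenerate_face[r deg].
have [i ik ir] : exists2 i, i != k & i = r :> nat \/ i = r.+1 :> nat.
  have [kr|kr] := eqVneq k (lift ord0 r); last by exists (lift ord0 r); [rewrite eq_sym | right].
  exists (widen_ord (leqnSn _) r); last by left.
  by rewrite kr -val_eqE /= /bump; lia.
have [z iy rz] := deg i ir.
suff zP : dom P z by apply: (dom_face (f := codegen r : simp n.+1 n) zP); rewrite rz mem_head.
have := horn_in _ (ordmap_comp (coface i) (ordmap_id _)) (coface_in_horn _ ik) z.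
by rewrite ordmap_compm1 iy mem_head; apply.
Qed.

(** Filling a horn attaches the missing face first and then the cell itself. *)
Lemma attach_horn (P : partial_hom) n (k : 'I_n.+2) (y : Y n.+1) (x : Y n) (v : E n.+1) :
  face (coface k) y = [:: x] -> ~ dom P x -> ~ dom P y ->
  (forall m (f : simp m n.+1), in_horn k f -> faces_in P f y v) ->
  exists Q : partial_hom, [/\ ple P Q, dom Q y, pval Q y = v &
    forall m (z : Y m), dom Q z -> [\/ dom P z,
      exists2 f : simp m n, ~~ in_boundary f & face f x = [:: z] |
      exists2 f : simp m n.+1, ~~ in_boundary f & face f y = [:: z]]].
Proof.
move=> yx xP yP horn_in; pose w := smon_act E (coface k : simp n n.+1) v.
have x_boundary m (f : simp m n) : in_boundary f -> faces_in P f x w.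
  move=> f_bd; rewrite /faces_in -(face_comp1 f yx) -smon_act_comp.
  by apply: horn_in; rewrite boundary_coface.
have [Q [PQ Qx Qw Qnew]] := attach_cell xP x_boundary.
have yQ : ~ dom Q y.
  move=> /Qnew[//|[f f_onto fx]].
  apply/yP/(degenerate_dom (k := k)) => [m g /horn_in[]//|y_nd].
  by have [e _] := nondeg_onto f_onto fx y_nd; lia.
have y_boundary m (f : simp m n.+1) : in_boundary f -> faces_in Q f y v.
  move=> f_bd; have [/horn_in|] := boolP (in_horn k f); first exact: faces_in_le.
  move=> /(boundary_not_horn f_bd)[g ->]; apply: faces_in_comp.
  split=> [z|]; rewrite yx; first by rewrite inE => /eqP ->.
  by rewrite big_seq1 Qw.
have [R [QR Ry Rv Rnew]] := attach_cell yQ y_boundary.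
exists R; split=> // [|m z /Rnew[/Qnew[zP|xz]|yz]]; first exact: ple_trans QR.
- by constructor 1.
- by constructor 2.
- by constructor 3.
Qed.
End Partial.

(** * Extension along a pairing of cells *)

Section ChainUnion.
Variables (Y : basis) (E : smon) (A : set (partial_hom Y E)).
Hypothesis A_chain : forall P Q, A P -> A Q -> ple P Q \/ ple Q P.

Let udom n (y : Y n) := exists2 P, A P & dom P y.
Let uval n (y : Y n) : E n :=
  if pselect (exists P, A P /\ dom P y) is left e then pval (sval (cid e)) y else 1.

Let uvalE P n (y : Y n) : A P -> dom P y -> uval y = pval P y.
Proof.
move=> AP yP; rewrite /uval; case: pselect => [e|[]]; last by exists P.
case: cid => Q [AQ yQ] /=.
by case: (A_chain AP AQ) => [/(_ _ _ yP)[_ ->]|/(_ _ _ yQ)[_ ->]].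
Qed.

Let udom_face m n (f : simp m n) (y : Y n) :
  udom y -> forall z, z \in face f y -> udom z.
Proof. by move=> [P AP yP] z /(dom_face yP); exists P. Qed.

Let uval_face m n (f : simp m n) (y : Y n) :
  udom y -> smon_act E f (uval y) = \prod_(z <- face f y) uval z.
Proof.
move=> [P AP yP]; rewrite (uvalE AP yP) (pval_face f yP).
by apply: eq_big_seq => z /(dom_face yP) zP; rewrite (uvalE AP zP).
Qed.

Lemma chain_union : exists Q, (forall P, A P -> ple P Q) /\
  forall n (y : Y n), dom Q y -> exists2 P, A P & dom P y.
Proof.
exists (PartialHom udom_face uval_face); split=> // P AP n y yP.
by split; [exists P | exact: uvalE].
Qed.
End ChainUnion.

Section Pairing.
Variables (Y : basis) (E : smon) (P0 : partial_hom Y E).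
Variables (low : forall n, Y n -> Prop) (ins : forall n, Y n -> Y n.+1).
Variable pos : forall n, Y n -> 'I_n.+2.
Hypothesis ins_face : forall n (y : Y n), low y -> face (coface (pos y)) (ins y) = [:: y].
Hypothesis low_nondeg : forall n (y : Y n), low y -> nondeg y.
Hypothesis ins_high : forall n (y : Y n), low y -> ~ low (ins y).
Hypothesis low_new : forall n (y : Y n), low y -> ~ dom P0 y.

Let closed (P : partial_hom Y E) := forall n (y : Y n), low y -> dom P y -> dom P (ins y).

(** Zorn's lemma, applied to the partial morphisms that contain [ins y] whenever they contain
    a [low] cell [y]: otherwise [y] could have received a value that no value of [ins y]
    restricts to. Attaching a horn preserves this condition because the only nondegenerate
    cells it adds are [y] and [ins y]. *)
Theorem pairing_extension : exists P : partial_hom Y E, ple P0 P /\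
  forall n (y : Y n) v, low y ->
    (forall m (f : simp m n.+1), in_horn (pos y) f -> faces_in P f (ins y) v) ->
    dom P (ins y).
Proof.
pose T := {P : partial_hom Y E | ple P0 P /\ closed P}.
have P0T : ple P0 P0 /\ closed P0 by split=> // n y /low_new.
pose R (P Q : T) := `[< ple (sval P) (sval Q) >].
have [|||P Pmax] := @ZL_preorder T (exist _ P0 P0T) R.
- by move=> P; apply/asboolP.
- by move=> Q P S /asboolP PQ /asboolP QS; apply/asboolP/(ple_trans PQ).
- move=> A A_tot; pose A' := [set P | exists2 Q, A Q & sval Q = P]%classic.
  have [[Q0 AQ0]|A0] := pselect (exists Q, A Q); last first.
    by exists (exist _ P0 P0T) => Q AQ; case: A0; exists Q.
  have [|U [UA AU]] := @chain_union Y E A'.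
    move=> _ _ [P AP <-] [Q AQ <-].
    by case: (A_tot P Q AP AQ) => /asboolP; [left | right].
  have A'U P : A P -> ple (sval P) U by move=> AP; apply: UA; exists P.
  have UT : ple P0 U /\ closed U.
    split; first by apply: ple_trans (A'U _ AQ0); case: (svalP Q0).
    move=> n y y_low /AU[_ [Q AQ <-] yQ].
    by have [] := A'U Q AQ _ (ins y) ((svalP Q).2 _ _ y_low yQ).
  by exists (exist _ U UT) => Q AQ; apply/asboolP/A'U.
exists (sval P); have [P0P P_closed] := svalP P; split=> // n y v y_low y_horn.
apply: contrapT => yP.
have y_new : ~ dom (sval P) y by move=> /(P_closed _ _ y_low).
have [Q [PQ Qy _ Qnew]] := attach_horn (ins_face y_low) y_new yP y_horn.
have QT : ple P0 Q /\ closed Q.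
  split; first exact: ple_trans PQ.
  move=> m z z_low /Qnew[zP|[f f_onto fz]|[f f_onto fz]].
  - by have [] := PQ _ (ins z) (P_closed _ _ z_low zP).
  - have [e] := nondeg_onto f_onto fz (low_nondeg z_low).
    by subst m => /= ->.
  - have [e] := nondeg_onto f_onto fz (low_nondeg z_low).
    by subst m => /= ez; case: (ins_high y_low); rewrite -ez.
have /asboolP/(_ _ _ Qy)[] : R (exist _ Q QT) P by apply: Pmax; apply/asboolP.
by move/yP.
Qed.
End Pairing.

Lemma inner_horn_filler (E : smon) (E_qc : strict_monoidal_infty_category E)
    (Y : basis) (P : partial_hom Y E) n (k : 'I_n.+2) (y : Y n.+1) : 0 < k < n.+1 ->
  (forall m (f : simp m n.+1), in_horn k f -> forall z, z \in face f y -> dom P z) ->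
  exists v, forall m (f : simp m n.+1), in_horn k f -> faces_in P f y v.
Proof.
move=> k_inner horn_in.
pose h_ob m (f : horn k m) : E m := \prod_(z <- face (sval f) y) pval P z.
have h_nat m l (a : simp m l) (f : horn k l) : h_ob m (act a f) = smon_act E a (h_ob l f).
  by rewrite /h_ob /= face_comp prod_face //; apply: horn_in (svalP f).
have [s sh] := E_qc _ k k_inner (SSetHom (Y := usset E) h_nat).
exists (s n.+1 (ordmap_id n.+2)) => m f f_horn; split; first exact: horn_in f_horn.
have := congr1 (fun u : sset_hom (horn k) (usset E) => u m (exist _ f f_horn)) sh.
rewrite /= /h_ob /= => <-.
by rewrite -[LHS](sset_nat s) /= ordmap_comp1m.
Qed.

(** * Horns under the unit *)

HB.instance Definition _ k l := [Equality of ordmap k l by <:].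

Lemma card_initial n (P : pred 'I_n) :
  (forall i j : 'I_n, i <= j -> P j -> P i) -> forall i : 'I_n, (i < #|P|) = P i.
Proof.
move=> P_down i; have card_lt p : p <= n -> #|[pred j : 'I_n | j < p]| = p.
  move=> lepn; have w_inj : injective (widen_ord lepn).
    by move=> x y /(congr1 (@nat_of_ord n)) /=; apply: ord_inj.
  rewrite -[RHS]card_ord -(card_codom w_inj).
  apply: eq_card => j; rewrite inE; apply/idP/codomP => [ltjp|[x ->]]; last exact: (ltn_ord x).
  by exists (Ordinal ltjp); apply: ord_inj.
apply/idP/idP => [|Pi].
  apply: contraLR => nPi; rewrite -leqNgt -[X in _ <= X](card_lt i (ltnW (ltn_ord i))).
  apply/subset_leq_card/fintype.subsetP => j Pj; rewrite inE ltnNge.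
  by apply/negP => /P_down/(_ Pj); apply/negP.
rewrite -[X in X <= _](card_lt i.+1 (ltn_ord i)); apply/subset_leq_card/fintype.subsetP => j.
by rewrite inE ltnS => /P_down; apply.
Qed.

Lemma threshold_mono n p (i j : 'I_n) : i <= j ->
  (if p < i then ord_max else ord0 : 'I_2) <= (if p < j then ord_max else ord0 : 'I_2).
Proof. by move=> ij; case: ltnP => // /leq_trans ->. Qed.

(** Every [n]-simplex of the interval is of this form or constantly [1]. *)
Definition threshold n p : simp n 1 := mk_ordmap (@threshold_mono n.+1 p).

Lemma thresholdE n p i : threshold n p i = (if p < i then ord_max else ord0).
Proof. exact: mk_ordmapE. Qed.

Lemma eq_simp1 n (f g : simp n 1) : (forall i, (f i == ord0) = (g i == ord0)) -> f = g.
Proof.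
move=> fg; apply: ordmap_ext => i; move: (fg i).
case: (f i) (g i) => [[|[|?]] ?] [[|[|?]] ?] //= _; exact: ord_inj.
Qed.

Lemma sval_inj (T : Type) (P : T -> Prop) (x y : {z | P z}) : sval x = sval y -> x = y.
Proof. by case: x y => x Px [y Py] /= xy; apply: eq_exist. Qed.

Section PrismBasis.
Variable n : nat.

Let prism_cell m : eqType := (simp m n * simp m 1)%type.
Let prism_face l m (f : simp l m) (y : prism_cell m) : seq (prism_cell l) :=
  [:: (ordmap_comp y.1 f, ordmap_comp y.2 f)].

Definition prism : basis.
Proof.
exists prism_cell prism_face.
- by move=> m [f g]; rewrite /prism_face !ordmap_compm1.
- by move=> k l m b a [f g]; rewrite /prism_face /= !ordmap_compA.
- by move=> l m f y _; eexists.
Defined.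

Lemma prism_faceE l m (f : simp l m) (a : simp m n) (g : simp m 1) :
  face f ((a, g) : prism m) = [:: (ordmap_comp a f, ordmap_comp g f)].
Proof. by []. Qed.
End PrismBasis.

Section HornUnderUnit.
Variables (E : smon) (E_qc : strict_monoidal_infty_category E).
Variables (t : coaug E 0) (t_terminal : terminal t).

Definition coaug_edge : E 1%N := sval t 1%N (ordmap_const 2 ord0 : simp 1 0, ordmap_id 2).

Lemma degen_unit n : degen (unit_ob E) n = 1 :> E n.
Proof. exact: (@gmulf1 _ _ (smon_act E (ordmap_const n.+1 ord0))). Qed.

(* [W] stands for a map to [E] from the product of the horn at the vertex [0] with the
   interval; outside the horn its values are arbitrary. *)
Variables (m : nat) (W : forall r, simp r m.+2 -> simp r 1 -> E r).
Hypothesis W_nat : forall r s (a : simp s r) (f : simp r m.+2) (g : simp r 1),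
  in_horn ord0 f -> smon_act E a (W f g) = W (ordmap_comp f a) (ordmap_comp g a).
Hypothesis W_bottom : forall r (f : simp r m.+2) (g : simp r 1),
  in_horn ord0 f -> (forall i, g i = ord0) -> W f g = 1.
Hypothesis W_last : W (ordmap_const 2 ord_max) (ordmap_id 2) = coaug_edge.

Let up r (f : simp r m.+1) : simp r m.+2 := ordmap_comp (coface ord0) f.

Let up_horn r (f : simp r m.+1) : in_boundary f -> in_horn ord0 (up f).
Proof. by rewrite /up boundary_coface. Qed.

(** The prisms on the boundary of the face opposite to [0] form a sphere of coaugmented
    objects, since [W] is trivial on the bottom. Its last vertex is [t] by [W_last], so it
    has a filler. *)
Lemma sphere_prism_filler :
  exists K : sset_hom (sset_prod (std_simplex m.+1) (std_simplex 1)) (usset E),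
  (forall r (f : simp r m.+1) (g : simp r 1), in_boundary f -> K r (f, g) = W (up f) g) /\
  (forall r (f : simp r m.+1) (g : simp r 1), (forall i, g i = ord0) -> K r (f, g) = 1).
Proof.
have phi_nat r (f : boundary m.+1 r) l s (a : simp s l)
    (p : sset_prod (std_simplex r) (std_simplex 1) l) :
  W (up (ordmap_comp (sval f) (ordmap_comp p.1 a))) (ordmap_comp p.2 a) =
  smon_act E a (W (up (ordmap_comp (sval f) p.1)) p.2).
  rewrite W_nat; first by congr (W _ _); rewrite /up !ordmap_compA.
  exact/up_horn/(@in_boundary_act _ _ _ p.1 _ (svalP f)).
pose phi r (f : boundary m.+1 r) : sset_exp (usset E) (std_simplex 1) r :=
  SSetHom (X := sset_prod (std_simplex r) (std_simplex 1)) (Y := usset E)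
    (fun s l a p => phi_nat r f l s a p).
have phi0 r (f : boundary m.+1 r) : eval0 E r (phi r f) = degen (unit_ob E) r.
  rewrite degen_unit /= ordmap_compm1 W_bottom //; first exact/up_horn/(svalP f).
  by move=> i; rewrite ordmap_compE mk_ordmapE.
pose h_ob r (f : boundary m.+1 r) : coaug E r := exist _ (phi r f) (phi0 r f).
have h_nat s r (a : simp s r) (f : boundary m.+1 r) : h_ob s (act a f) = act a (h_ob r f).
  apply: eq_exist; apply: sset_hom_ext => l [c g] /=.
  by congr (W (up _) _); rewrite ordmap_compA.
have [|s sh] := t_terminal (h := SSetHom h_nat).
  apply: sval_inj; apply: sset_hom_ext => l [c g] /=.
  have -> : (c, g) = act (s := sset_prod (std_simplex 0) (std_simplex 1)) g
              (ordmap_const 2 ord0 : simp 1 0, ordmap_id 2).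
    rewrite /= ordmap_comp1m; congr pair; apply: ordmap_ext => i.
    by rewrite ordmap_compE mk_ordmapE [c i]ord1.
  rewrite (sset_nat (sval t)) /= -/coaug_edge -W_last W_nat; last first.
    apply/existsP; exists (lift ord0 ord0); rewrite eq_sym neq_lift /=.
    by apply/forallP => x; rewrite mk_ordmapE.
  rewrite ordmap_comp1m; congr (W _ _); apply: ordmap_ext => i.
  rewrite !ordmap_compE !mk_ordmapE; apply: ord_inj.
  by rewrite /= /bump.
exists (sval (s m.+1 (ordmap_id m.+2))); split=> [r f g f_bd|r f g g0].
  have := congr1 (fun u : sset_hom (boundary m.+1) (coaug E) =>
    sval (u r (exist _ f f_bd)) r (ordmap_id r.+1, g)) sh.
  rewrite /= ordmap_compm1 => <-.
  have -> : s r f = act f (s m.+1 (ordmap_id m.+2)) by rewrite -sset_nat /= ordmap_comp1m.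
  by rewrite /= ordmap_compm1.
have K0 : eval0 E _ (sval (s m.+1 (ordmap_id m.+2))) = 1 :> E m.+1.
  by rewrite -(degen_unit m.+1); apply: (svalP (s _ _)).
rewrite /= in K0.
have := congr1 (smon_act E f) K0; rewrite gmulf1 => <-.
rewrite -[RHS]sset_nat /= ordmap_comp1m.
set d := ordmap_comp _ f; have -> // : g = d.
by apply: ordmap_ext => i; rewrite /d !ordmap_compE mk_ordmapE g0.
Qed.


Section Filler.
Variable K : forall r, simp r m.+1 -> simp r 1 -> E r.
Hypothesis K_nat : forall r s (a : simp s r) (f : simp r m.+1) g,
  smon_act E a (K f g) = K (ordmap_comp f a) (ordmap_comp g a).
Hypothesis K_boundary : forall r (f : simp r m.+1) g, in_boundary f -> K f g = W (up f) g.
Hypothesis K_bottom : forall r (f : simp r m.+1) (g : simp r 1),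
  (forall i, g i = ord0) -> K f g = 1.

(* The partial morphism on the prism over the [m+2]-simplex that is to be extended: it is
   [W] on the horn, [K] on the face opposite to [0] and trivial on the bottom. *)
Let avoids r (f : simp r m.+2) := [forall i, f i != ord0].
Let zero r (g : simp r 1) := [forall i, g i == ord0].
Let down r (f : simp r m.+2) : simp r m.+1 := ordmap_comp (codegen ord0) f.

Let dom0 r (y : prism m.+2 r) : Prop := [|| in_horn ord0 y.1, avoids y.1 | zero y.2].
Let val0 r (y : prism m.+2 r) : E r :=
  if in_horn ord0 y.1 then W y.1 y.2 else if zero y.2 then 1 else K (down y.1) y.2.

Let avoids_up r (f : simp r m.+2) : avoids f -> f = up (down f).
Proof.
move=> /forallP f0; have [g ->] := coface_factor f0.
by rewrite /up /down (ordmap_compA (codegen _)) codegenK ?ordmap_comp1m //; left.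
Qed.

Let zeroP r (g : simp r 1) : reflect (forall i, g i = ord0) (zero g).
Proof. exact: eqfunP. Qed.

Let avoids_comp r s (f : simp r m.+2) (a : simp s r) : avoids f -> avoids (ordmap_comp f a).
Proof. by move=> /forallP f0; apply/forallP => i; rewrite ordmap_compE. Qed.

Let zero_comp r s (g : simp r 1) (a : simp s r) : zero g -> zero (ordmap_comp g a).
Proof. by move=> /zeroP g0; apply/zeroP => i; rewrite ordmap_compE. Qed.

Let val0_horn r (f : simp r m.+2) g : in_horn ord0 f -> val0 (f, g) = W f g.
Proof. by rewrite /val0 => ->. Qed.

Let val0_zero r (f : simp r m.+2) g : zero g -> val0 (f, g) = 1.
Proof.
by rewrite /val0 /= => /[dup]/zeroP g0 ->; case: ifP => // f_horn; apply: W_bottom.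
Qed.

Let val0_avoids r (f : simp r m.+2) g : avoids f -> val0 (f, g) = K (down f) g.
Proof.
move=> /avoids_up f0; rewrite /val0 /=; case: ifP => [f_horn|_].
  rewrite K_boundary; first by rewrite -f0.
  by rewrite -(boundary_coface ord0) -[ordmap_comp _ _]/(up (down f)) -f0.
by case: ifP => // /zeroP g0; rewrite K_bottom.
Qed.

Let dom0_face s r (a : simp s r) (y : prism m.+2 r) :
  dom0 y -> forall z, z \in face a y -> dom0 z.
Proof.
case: y => f g; rewrite /dom0 => y0 z; rewrite prism_faceE inE => /eqP -> /=.
case/or3P: y0 => /=.
- by move/(@in_horn_act _ _ _ _ a) => ->.
- by move/avoids_comp => ->; rewrite orbT.
- by move/zero_comp => ->; rewrite !orbT.
Qed.

Let val0_face s r (a : simp s r) (y : prism m.+2 r) :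
  dom0 y -> smon_act E a (val0 y) = \prod_(z <- face a y) val0 z.
Proof.
case: y => f g; rewrite prism_faceE big_seq1.
case/or3P => /= y0.
- by rewrite !val0_horn ?W_nat //; apply: (@in_horn_act _ _ _ _ a).
- rewrite !val0_avoids ?K_nat ?avoids_comp //.
  by rewrite /down ordmap_compA.
- by rewrite !val0_zero ?gmulf1 ?zero_comp.
Qed.

Let P0 : partial_hom (prism m.+2) E := PartialHom dom0_face val0_face.

(* The low cells are (0,0), ..., (p-1,0), (p,1), ..., (m+2,1) with 0 < p <= m+2, where p is
   [zeros y], and insertion adds the vertex (p,0). *)
Let low n (y : prism m.+2 n) : Prop :=
  [/\ injective y.1, ~~ in_boundary y.1, y.2 ord0 = ord0 & ~~ zero y.2].
Let zeros n (y : prism m.+2 n) : nat := #|[pred i | y.2 i == ord0]|.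
Let ins n (y : prism m.+2 n) : prism m.+2 n.+1 :=
  (ordmap_comp y.1 (codegen (inord (zeros y))), threshold n.+1 (zeros y)).
Let pos n (y : prism m.+2 n) : 'I_n.+2 := inord (zeros y).

Let zerosP n (y : prism m.+2 n) (i : 'I_n.+1) : (i < zeros y) = (y.2 i == ord0).
Proof.
rewrite /zeros (card_initial (P := [pred i | y.2 i == ord0])) // => {}i j ij /=.
by move=> /eqP yj; have := ordmap_mono y.2 ij; rewrite yj -val_eqE /=; lia.
Qed.

Let zeros_bounds n (y : prism m.+2 n) : low y -> 0 < zeros y < n.+1.
Proof.
move=> [_ _ y0 /forallPn[i]]; rewrite -zerosP.
have := zerosP y ord0; rewrite y0 eqxx => -> /=.
by rewrite -leqNgt => /leq_ltn_trans; apply; apply: ltn_ord.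
Qed.

Let ins_face n (y : prism m.+2 n) : low y -> face (coface (pos y)) (ins y) = [:: y].
Proof.
move=> y_low; have /andP[p0 pn] := zeros_bounds y_low.
rewrite prism_faceE [in RHS](surjective_pairing y); congr [:: (_, _)].
  rewrite -ordmap_compA codegenK ?ordmap_compm1 //; left.
  by rewrite !inordK //; lia.
apply: eq_simp1 => i; rewrite ordmap_compE thresholdE cofaceE -zerosP /= inordK; last by lia.
have -> : (zeros y < bump (zeros y) i) = (zeros y <= i) by rewrite /bump; lia.
by rewrite leqNgt; case: ltnP.
Qed.

Let face_dom (P : partial_hom (prism m.+2) E) n (y : prism m.+2 n) (k : 'I_n.+2) :
  (forall i, i != k -> dom P
    (ordmap_comp (ordmap_comp y.1 (codegen (inord (zeros y)))) (coface i),
     ordmap_comp (threshold n.+1 (zeros y)) (coface i))) ->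
  forall r (f : simp r n.+1), in_horn k f -> forall z, z \in face f (ins y) -> dom P z.
Proof.
move=> yP r f /in_hornP[i [g [ik ->]]] z.
by rewrite (face_comp1 _ (prism_faceE _ _ _)); apply/dom_face/yP.
Qed.

(** The face of [ins y] opposite to (p,1) is the low cell with p+1 in place of p, or lies in
    the bottom if p = m+2; so the cells are attached by descending induction on p, until
    p = 1: the low cell is then the copy of the [m+2]-simplex with the vertex [0] at the
    bottom and the others at the top. All horns are inner since the vertex (0,0) comes
    before (p,0). *)
Lemma prism_horn_filler : exists w : E m.+2, forall r (f : simp r m.+2), in_horn ord0 f ->
  smon_act E f w = W f (ordmap_comp (threshold m.+2 0) f).
Proof.
have [|||P [P0P P_closed]] := @pairing_extension (prism m.+2) E P0 low ins pos ins_face.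
- move=> n [f g] [/= f_inj _ _ _] e; rewrite prism_faceE => -[fe _].
  apply: ordmap_ext => i; rewrite ordmap_idE; apply: f_inj.
  by rewrite -ordmap_compE fe.
- move=> n y y_low [f_inj _ _ _].
  have insE i : (ins y).1 i = y.1 (codegen (inord (zeros y)) i) := ordmap_compE _ _ i.
  have c_inj : injective (codegen (inord (zeros y) : 'I_n.+1)).
    by move=> i j cij; apply: f_inj; rewrite !insE cij.
  by have := leq_card _ c_inj; rewrite !card_ord ltnn.
- move=> n [f g] [/= f_inj /ontoP f_onto _ /negbTE g0]; rewrite /dom0 /= g0 orbF.
  case/orP=> [/existsP[i /andP[_ /forallP fi]]|/forallP f0].
    by have [x fx] := f_onto i; move: (fi x); rewrite fx eqxx.
  by have [x fx] := f_onto ord0; move: (f0 x); rewrite fx eqxx.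
have ins_dom d n (y : prism m.+2 n) : low y -> n.+1 - zeros y <= d -> dom P (ins y).
  elim: d n y => [|d IH] n y y_low le_d; have /andP[p0 pn] := zeros_bounds y_low.
    by move: le_d; lia.
  have pE : (inord (zeros y) : 'I_n.+1) = zeros y :> nat by rewrite inordK.
  have posE : pos y = zeros y :> nat by rewrite inordK // ltnW.
  have pos_inner : 0 < pos y < n.+1 by rewrite posE p0.
  have faces_dom := face_dom (k := pos y) (y := y) (P := P) _.
  have {}faces_dom r (f : simp r n.+1) : in_horn (pos y) f ->
      forall z, z \in face f (ins y) -> dom P z.
    apply: faces_dom => i ip; have [i_next|i_next] := eqVneq (i : nat) (zeros y).+1.
      rewrite -ordmap_compA codegenK ?pE ?ordmap_compm1; last by right.
      set g := ordmap_comp _ _; have gE x : (g x == ord0) = (x <= zeros y).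
        rewrite ordmap_compE thresholdE cofaceE /= i_next.
        have -> : (zeros y < bump (zeros y).+1 x) = (zeros y < x) by rewrite /bump; lia.
        by rewrite [RHS]leqNgt; case: ltnP.
      have [g0|g0] := boolP (zero g).
        by case: (P0P _ (y.1, g) (introT or3P (Or33 _ _ g0))).
      pose z : prism m.+2 n := (y.1, g).
      have z_low : low z.
        case: y_low => y_inj y_onto _ _; split=> //=.
        by apply/eqP; rewrite gE.
      have lt_z : zeros y < zeros z by rewrite -pE zerosP gE pE.
      apply: (dom_face (f := coface (pos z) : simp n n.+1) (IH n z z_low _)).
        by move: le_d lt_z; lia.
      by rewrite ins_face ?mem_head.
    have [y_inj _ _ _] := y_low.
    have miss x : codegen (inord (zeros y) : 'I_n.+1) (lift i x) != codegen (inord (zeros y)) i.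
      rewrite -val_eqE /= !codegenE pE /= /bump /unbump; move: ip; rewrite -val_eqE /= posE.
      by lia.
    have [|//] := P0P _ (ordmap_comp (ordmap_comp y.1 (codegen (inord (zeros y)))) (coface i),
      ordmap_comp (threshold n.+1 (zeros y)) (coface i)).
    rewrite /= /dom0 /=; have [y1i|y1i] := eqVneq (y.1 (codegen (inord (zeros y)) i)) ord0.
      suff -> : avoids (ordmap_comp (ordmap_comp y.1 (codegen (inord (zeros y)))) (coface i)).
        by rewrite orbT.
      by apply/forallP => x; rewrite !ordmap_compE cofaceE -y1i (inj_eq y_inj).
    apply/orP; left; apply/existsP; exists (y.1 (codegen (inord (zeros y)) i)).
    by rewrite y1i; apply/forallP => x; rewrite !ordmap_compE cofaceE (inj_eq y_inj).
  have [v v_faces] := inner_horn_filler E_qc (P := P) (k := pos y) (y := ins y) pos_inner faces_dom.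
  exact: (P_closed _ _ v).
pose y0 : prism m.+2 m.+2 := (ordmap_id m.+3, threshold m.+2 0).
have y0_low : low y0.
  split=> /=; rewrite ?id_onto ?thresholdE //.
    by move=> i j; rewrite !ordmap_idE.
  by apply/forallPn; exists ord_max; rewrite thresholdE.
have y0P : dom P y0.
  apply: (dom_face (f := coface (pos y0) : simp m.+2 m.+3) (ins_dom _ _ _ y0_low (leqnn _))).
  by rewrite ins_face // mem_head.
exists (pval P y0) => r f f_horn; rewrite (pval_face f y0P) prism_faceE big_seq1 ordmap_comp1m.
have f_dom : dom0 (f, ordmap_comp (threshold m.+2 0) f : simp r 1).
  by rewrite /dom0 f_horn.
by have [_ ->] := P0P _ _ f_dom; exact: val0_horn.
Qed.
End Filler.

(** The horn to be filled is the restriction of [W] to the simplices with the vertex [0] at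
    the bottom and the others at the top. It is not enough to know it alone: a filler of the
    sphere of coaugmented objects is a prism, and [W] connects this prism to the horn. *)
Theorem horn_under_unit : exists w : E m.+2, forall r (f : simp r m.+2), in_horn ord0 f ->
  smon_act E f w = W f (ordmap_comp (threshold m.+2 0) f).
Proof.
have [K [K_boundary K_bottom]] := sphere_prism_filler.
apply: (@prism_horn_filler (fun r f g => K r (f, g))) => // r s a f g.
exact: (esym (sset_nat K a (f, g))).
Qed.
End HornUnderUnit.

(** * Chains of finite ordinals *)

Notation chain := (smon_ob NDelta_plus).

Definition clen n (F : chain n) (i : 'I_n.+1) : nat :=
  fun_ob (F : functor (ord_cat n) Delta_plus) i.

Definition cmor n (F : chain n) (i j : 'I_n.+1) (ij : i <= j) : ordmap (clen F i) (clen F j) :=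
  fun_hom (F : functor (ord_cat n) Delta_plus) ij.

(** The transition maps of a chain as functions on [nat], which makes equations between
    chains with propositionally equal ordinals meaningful; outside the source the value
    is [0]. *)
Definition cmap n (F : chain n) (i j : 'I_n.+1) (x : nat) : nat :=
  if @idP (i <= j) is ReflectT ij
  then oapp (fun y : 'I_(clen F i) => nat_of_ord (cmor F ij y)) 0 (insub x) else 0.

Section ChainMaps.
Variables (n : nat) (F : chain n).

Lemma cmapE (i j : 'I_n.+1) (ij : i <= j) (x : 'I_(clen F i)) : cmap F i j x = cmor F ij x.
Proof.
rewrite /cmap; case: {-}_ / idP => [ij'|//]; rewrite (bool_irrelevance ij' ij).
by rewrite valK.
Qed.

Lemma cmap_lt (i j : 'I_n.+1) x : i <= j -> x < clen F i -> cmap F i j x < clen F j.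
Proof. by move=> ij xi; rewrite (cmapE ij (Ordinal xi)). Qed.

Lemma cmap_mono (i j : 'I_n.+1) x y :
  i <= j -> x <= y -> y < clen F i -> cmap F i j x <= cmap F i j y.
Proof.
move=> ij xy yi; have xi := leq_ltn_trans xy yi.
by rewrite (cmapE ij (Ordinal xi)) (cmapE ij (Ordinal yi)); apply: ordmap_mono.
Qed.

Lemma cmap_id (i : 'I_n.+1) x : x < clen F i -> cmap F i i x = x.
Proof.
move=> xi; rewrite (cmapE (leqnn i) (Ordinal xi)).
have := fun_id (F : functor (ord_cat n) Delta_plus) i; rewrite /cmor /= => e.
rewrite (bool_irrelevance (leqnn i) (@idm (ord_cat n) i)) e.
exact: (congr1 (@nat_of_ord _) (ordmap_idE (Ordinal xi))).
Qed.

Lemma cmap_comp (i j k : 'I_n.+1) x : i <= j -> j <= k -> x < clen F i ->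
  cmap F j k (cmap F i j x) = cmap F i k x.
Proof.
move=> ij jk xi; rewrite (cmapE ij (Ordinal xi)) (cmapE jk) (cmapE (leq_trans ij jk) (Ordinal xi)).
have := @fun_comp _ _ (F : functor (ord_cat n) Delta_plus) i j k jk ij.
rewrite /cmor => e.
rewrite (bool_irrelevance (leq_trans ij jk) (@compm (ord_cat n) i j k jk ij)) e.
exact/esym/(congr1 (@nat_of_ord _))/ordmap_compE.
Qed.

Lemma clen_eq0 (i j : 'I_n.+1) : i <= j -> clen F j = 0 -> clen F i = 0.
Proof.
move=> ij j0; case Fi : (clen F i) => [//|a].
have : 0 < clen F i by rewrite Fi.
by move=> /(cmap_lt ij); rewrite j0.
Qed.
End ChainMaps.

Lemma chain_ext n (F G : chain n) : (forall i, clen F i = clen G i) ->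
  (forall (i j : 'I_n.+1) x, i <= j -> x < clen F i -> cmap F i j x = cmap G i j x) -> F = G.
Proof.
move=> len map; apply: functor_ext => i j ij; apply: ordmap_arr_eq => [||x y xy].
- exact: len.
- exact: len.
by rewrite -[LHS](cmapE (F := F)) -[RHS](cmapE (F := G)) xy map // -xy; apply: ltn_ord.
Qed.

Section MkChain.
Variables (n : nat) (a : 'I_n.+1 -> nat) (m : 'I_n.+1 -> 'I_n.+1 -> nat -> nat).
Hypothesis m_lt : forall (i j : 'I_n.+1) x, i <= j -> x < a i -> m i j x < a j.
Hypothesis m_mono : forall (i j : 'I_n.+1) x y, i <= j -> x <= y -> y < a i -> m i j x <= m i j y.
Hypothesis m_id : forall i x, x < a i -> m i i x = x.
Hypothesis m_comp : forall (i j k : 'I_n.+1) x,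
  i <= j -> j <= k -> x < a i -> m j k (m i j x) = m i k x.

Let step (i j : 'I_n.+1) (ij : i <= j) (x : 'I_(a i)) : 'I_(a j) := Ordinal (m_lt ij (ltn_ord x)).

Definition mk_chain : chain n.
Proof.
refine (@Functor (ord_cat n) Delta_plus a (fun i j ij =>
  @mk_ordmap (a i) (a j) (step ij) (fun x y xy => m_mono ij xy (ltn_ord y))) _ _).
- by move=> i; apply: ordmap_ext => x; apply: ord_inj; rewrite ordmap_idE mk_ordmapE /= m_id.
move=> i j k jk ij; apply: ordmap_ext => x; apply: ord_inj.
by rewrite ordmap_compE !mk_ordmapE /= m_comp.
Defined.

Lemma clen_mk i : clen mk_chain i = a i. Proof. by []. Qed.

Lemma cmap_mk (i j : 'I_n.+1) x : i <= j -> x < a i -> cmap mk_chain i j x = m i j x.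
Proof.
by move=> ij xi; rewrite (cmapE (F := mk_chain) ij (Ordinal xi)) [cmor _ _ _]mk_ordmapE.
Qed.
End MkChain.

Lemma clen_act m n (f : simp m n) (F : chain n) i :
  clen (smon_act NDelta_plus f F) i = clen F (f i).
Proof. by []. Qed.

Lemma cmap_act m n (f : simp m n) (F : chain n) (i j : 'I_m.+1) x : i <= j ->
  x < clen F (f i) -> cmap (smon_act NDelta_plus f F) i j x = cmap F (f i) (f j) x.
Proof.
move=> ij xi; rewrite (cmapE (F := F) (ordmap_mono f ij) (Ordinal xi)).
by rewrite (cmapE (F := smon_act NDelta_plus f F) ij (Ordinal xi)).
Qed.

Lemma clen_mul n (F G : chain n) i : clen (F * G) i = (clen F i + clen G i)%N.
Proof. by []. Qed.

Lemma clen_one n i : clen (1 : chain n) i = 0.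
Proof. by []. Qed.

Lemma cmap_mul n (F G : chain n) (i j : 'I_n.+1) x : i <= j -> x < clen F i + clen G i ->
  cmap (F * G) i j x = if x < clen F i then cmap F i j x
                       else (clen F j + cmap G i j (x - clen F i))%N.
Proof.
move=> ij xFG; rewrite (cmapE (F := F * G) ij (Ordinal xFG)).
rewrite [LHS](join_val (cmor F ij) (cmor G ij) (Ordinal xFG)).
case: splitP => y /= ->.
  by rewrite ltn_ord cmapE.
by rewrite ltnNge leq_addr addKn cmapE.
Qed.

Lemma chain0 n (F : chain n) : clen F ord_max = 0 -> F = 1.
Proof.
move=> F0; have Fi0 i : clen F i = 0 by apply: clen_eq0 F0; apply: leq_ord.
by apply: chain_ext => [//|i j x ij]; rewrite Fi0.
Qed.

(** * Unique factorization of chains *)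

Lemma leq_ord_max n (i : 'I_n.+1) : i <= (ord_max : 'I_n.+1).
Proof. exact: leq_ord. Qed.

Section SplitFirst.
Variables (n : nat) (F : chain n).

(* The fiber of [F] over the first point of its last ordinal is an initial segment in each
   degree, of cardinal [c i]; the complementary segments have cardinal [d i]. *)

Let c (i : 'I_n.+1) : nat := #|[pred x : 'I_(clen F i) | cmap F i ord_max x < 1]|.

Let c_le i : c i <= clen F i.
Proof. by rewrite -[X in _ <= X]card_ord; apply: max_card. Qed.

Let cP i x : x < clen F i -> (x < c i) = (cmap F i ord_max x < 1).
Proof.
move=> xi; pose P := [pred x : 'I_(clen F i) | cmap F i ord_max x < 1].
have := @card_initial _ P _ (Ordinal xi); apply=> y z yz /=.
by apply: leq_ltn_trans; apply: cmap_mono => //; apply: leq_ord.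
Qed.

Let c_map (i j : 'I_n.+1) x : i <= j -> x < clen F i -> (cmap F i j x < c j) = (x < c i).
Proof. by move=> ij xi; rewrite !cP ?cmap_lt // cmap_comp // leq_ord. Qed.

Let c_lt i x : x < c i -> x < clen F i.
Proof. by move/leq_trans; apply. Qed.

Let d (i : 'I_n.+1) : nat := clen F i - c i.
Let dmap (i j : 'I_n.+1) (x : nat) : nat := cmap F i j (x + c i) - c j.

Let d_lt i x : x < d i -> x + c i < clen F i.
Proof. by rewrite /d; lia. Qed.

Let d_ge (i j : 'I_n.+1) x : i <= j -> x < d i -> c j <= cmap F i j (x + c i).
Proof. by move=> ij xi; rewrite leqNgt c_map ?d_lt // -leqNgt leq_addl. Qed.

Lemma split_first b : clen F ord_max = b.+1 ->
  exists G H, [/\ F = G * H, clen G ord_max = 1%N & clen H ord_max = b].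
Proof.
have G1 (i j : 'I_n.+1) x : i <= j -> x < c i -> cmap F i j x < c j.
  by move=> ij xi; rewrite c_map ?c_lt.
have G2 (i j : 'I_n.+1) x y : i <= j -> x <= y -> y < c i -> cmap F i j x <= cmap F i j y.
  by move=> ij xy /c_lt; apply: cmap_mono.
have G3 (i : 'I_n.+1) x : x < c i -> cmap F i i x = x by move/c_lt; apply: cmap_id.
have G4 (i j k : 'I_n.+1) x : i <= j -> j <= k -> x < c i ->
    cmap F j k (cmap F i j x) = cmap F i k x.
  by move=> ij jk /c_lt; apply: cmap_comp.
have H1 (i j : 'I_n.+1) x : i <= j -> x < d i -> dmap i j x < d j.
  move=> ij xi; have := cmap_lt ij (d_lt xi); have := d_ge ij xi.
  by rewrite /dmap /d; lia.
have H2 (i j : 'I_n.+1) x y : i <= j -> x <= y -> y < d i -> dmap i j x <= dmap i j y.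
  by move=> ij xy yi; apply/leq_sub2r/(cmap_mono ij _ (d_lt yi)); rewrite leq_add2r.
have H3 (i : 'I_n.+1) x : x < d i -> dmap i i x = x.
  by move=> xi; rewrite /dmap (cmap_id (d_lt xi)) addnK.
have H4 (i j k : 'I_n.+1) x : i <= j -> j <= k -> x < d i -> dmap j k (dmap i j x) = dmap i k x.
  move=> ij jk xi; rewrite /dmap subnK ?d_ge // cmap_comp //; exact: d_lt.
move=> Fb; exists (mk_chain G1 G2 G3 G4), (mk_chain H1 H2 H3 H4).
have c1 : c ord_max = 1%N.
  have lt0 : 0 < clen F ord_max by rewrite Fb.
  have := cP lt0; rewrite cmap_id //= => c_gt0.
  have [b0|b0] := posnP b; first by have := c_le ord_max; rewrite Fb b0; lia.
  have lt1 : 1 < clen F ord_max by rewrite Fb.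
  by have := cP lt1; rewrite cmap_id //= => /negbT; rewrite -leqNgt; lia.
split=> //; last by rewrite clen_mk /d Fb c1 subn1.
apply: chain_ext => [i|i j x ij xi]; first by rewrite clen_mul !clen_mk /d subnKC.
rewrite cmap_mul //; last by rewrite !clen_mk /d subnKC.
rewrite !clen_mk; case: ltnP => cx; first by rewrite cmap_mk.
have xd : x - c i < d i by rewrite /d; move: (c_le i); lia.
rewrite cmap_mk // /dmap subnK // subnKC //.
by have := d_ge ij xd; rewrite subnK.
Qed.
End SplitFirst.

Lemma mul_chain_fiber n (G H : chain n) i x : x < clen (G * H) i ->
  (cmap (G * H) i ord_max x < clen G ord_max) = (x < clen G i).
Proof.
move=> xi; rewrite cmap_mul ?leq_ord_max //; case: (ltnP x (clen G i)) => [xG|_].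
  by rewrite cmap_lt // leq_ord_max.
by rewrite ltnNge leq_addr.
Qed.

(** In a product, the points of the first factor are those lying over the points of its
    last ordinal, so the last ordinals determine the factors. *)
Lemma mul_chain_inj n (G H G' H' : chain n) :
  G * H = G' * H' -> clen G ord_max = clen G' ord_max -> G = G' /\ H = H'.
Proof.
move=> GH G1.
have GHi i : (clen G i + clen H i = clen G' i + clen H' i)%N by rewrite -!clen_mul GH.
have lenG i : clen G i = clen G' i.
  have GG' x : x < clen (G * H) i -> (x < clen G i) = (x < clen G' i).
    by move=> xi; rewrite -(mul_chain_fiber xi) GH G1 mul_chain_fiber // -GH.
  have := GHi i; have := clen_mul G H i => GHlen.
  case: (ltngtP (clen G i) (clen G' i)) => // lt _.
    by have := GG' (clen G i); rewrite ltnn lt GHlen; have := GHi i; lia.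
  by have := GG' (clen G' i); rewrite ltnn lt GHlen; have := GHi i; lia.
have lenH i : clen H i = clen H' i by have := GHi i; rewrite lenG => /addnI.
split; apply: chain_ext => // i j x ij xi.
  have := congr1 (fun F : chain n => cmap F i j x) GH.
  by rewrite !cmap_mul ?ltn_addr // -?lenG // xi.
have := congr1 (fun F : chain n => cmap F i j (clen G i + x)) GH.
rewrite !cmap_mul ?ltn_add2l // -?lenG -?lenH ?ltn_add2l //.
by rewrite ltnNge leq_addr addKn => /addnI.
Qed.

Definition gen n := {F : chain n | clen F ord_max == 1%N}.

Definition to_gen n (F : chain n) (F1 : clen F ord_max = 1%N) : gen n :=
  exist _ F (introT eqP F1).

Definition gen_prod n (s : seq (gen n)) : chain n := \prod_(g <- s) val g.

Lemma gen_len n (g : gen n) : clen (val g) ord_max = 1%N.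
Proof. exact/eqP/(valP g). Qed.

Lemma gen_prod_cons n g (s : seq (gen n)) : gen_prod (g :: s) = val g * gen_prod s.
Proof. exact: big_cons. Qed.

Lemma gen_prod_size n (s : seq (gen n)) : clen (gen_prod s) ord_max = size s.
Proof.
elim: s => [|g s IH]; first by rewrite /gen_prod big_nil.
by rewrite gen_prod_cons clen_mul IH gen_len.
Qed.

Lemma gen_prod_surj n (F : chain n) : exists s : seq (gen n), gen_prod s = F.
Proof.
move eb : (clen F ord_max) => b; elim: b F eb => [|b IH] F Fb.
  by exists [::]; rewrite /gen_prod big_nil (chain0 Fb).
have [G [H [-> G1 /IH[s <-]]]] := split_first Fb.
by exists (to_gen G1 :: s); rewrite gen_prod_cons.
Qed.

Lemma gen_prod_inj n : injective (@gen_prod n).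
Proof.
elim=> [|g s IH] [|g' s'] // e; have := congr1 (fun F : chain n => clen F ord_max) e.
- by rewrite !gen_prod_size.
- by rewrite !gen_prod_size.
move=> _; move: e; rewrite !gen_prod_cons => /mul_chain_inj[]; first by rewrite !gen_len.
by move=> /val_inj -> /IH ->.
Qed.

Definition factors n (F : chain n) : seq (gen n) := sval (cid (gen_prod_surj F)).

Lemma factorsK n (F : chain n) : gen_prod (factors F) = F.
Proof. exact: (svalP (cid (gen_prod_surj F))). Qed.

Lemma factors_mul n (F G : chain n) : factors (F * G) = factors F ++ factors G.
Proof. by apply: gen_prod_inj; rewrite factorsK /gen_prod big_cat /= -!/(gen_prod _) !factorsK. Qed.

Lemma factors_one n : factors (1 : chain n) = [::].
Proof. by apply: gen_prod_inj; rewrite factorsK /gen_prod big_nil. Qed.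

Lemma factors_gen n (g : gen n) : factors (val g) = [:: g].
Proof. by apply: gen_prod_inj; rewrite factorsK /gen_prod big_seq1. Qed.

Lemma factors_prod n I (s : seq I) (F : I -> chain n) :
  factors (\prod_(i <- s) F i) = flatten [seq factors (F i) | i <- s].
Proof.
elim: s => [|i s IH]; first by rewrite big_nil factors_one.
by rewrite big_cons factors_mul IH.
Qed.

Lemma factor_len n (F : chain n) (g : gen n) i : g \in factors F -> clen (val g) i <= clen F i.
Proof.
rewrite -{2}(factorsK F); elim: (factors F) => // h s IH; rewrite inE gen_prod_cons clen_mul.
by case/predU1P => [->|/IH]; [exact: leq_addr | move/leq_trans; apply; exact: leq_addl].
Qed.

(** * Truncations of chains *)

Section Truncate.
Variables (n : nat) (c : simp n 1) (F : chain n).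

Let a (i : 'I_n.+1) : nat := if c i == ord0 then 0 else clen F i.

Let a_neq0 i x : x < a i -> (c i == ord0) = false /\ x < clen F i.
Proof. by rewrite /a; case: ifP. Qed.

Let c_neq0 (i j : 'I_n.+1) : i <= j -> (c i == ord0) = false -> (c j == ord0) = false.
Proof. by move=> /(ordmap_mono c); rewrite -!val_eqE /=; lia. Qed.

Lemma truncate_subproof : {M : chain n | (forall i, clen M i = a i) /\
  forall (i j : 'I_n.+1) x, i <= j -> x < a i -> cmap M i j x = cmap F i j x}.
Proof.
have m1 (i j : 'I_n.+1) x : i <= j -> x < a i -> cmap F i j x < a j.
  by move=> ij /a_neq0[ci xi]; rewrite /a (c_neq0 ij ci) cmap_lt.
have m2 (i j : 'I_n.+1) x y : i <= j -> x <= y -> y < a i -> cmap F i j x <= cmap F i j y.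
  by move=> ij xy /a_neq0[_ yi]; apply: cmap_mono.
have m3 (i : 'I_n.+1) x : x < a i -> cmap F i i x = x by move/a_neq0 => [_ xi]; apply: cmap_id.
have m4 (i j k : 'I_n.+1) x : i <= j -> j <= k -> x < a i ->
    cmap F j k (cmap F i j x) = cmap F i k x.
  by move=> ij jk /a_neq0[_ xi]; apply: cmap_comp.
by exists (mk_chain m1 m2 m3 m4); split=> // i j x ij xi; apply: cmap_mk.
Qed.

(** Replacing an initial part of a chain by the empty ordinal is functorial. Up to
    degeneracy, the simplices of the prisms and cones on [F] over the unit are of this form. *)
Definition truncate : chain n := sval truncate_subproof.

Lemma clen_truncate i : clen truncate i = if c i == ord0 then 0 else clen F i.
Proof. exact: (svalP truncate_subproof).1. Qed.

Lemma cmap_truncate (i j : 'I_n.+1) x :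
  i <= j -> x < clen truncate i -> cmap truncate i j x = cmap F i j x.
Proof. by move=> ij; rewrite clen_truncate; apply: (svalP truncate_subproof).2. Qed.
End Truncate.

Lemma truncate_id n (c : simp n 1) (F : chain n) :
  (forall i, c i = ord0 -> clen F i = 0) -> truncate c F = F.
Proof.
move=> cF; apply: chain_ext => [i|i j x ij]; last exact: cmap_truncate.
by rewrite clen_truncate; case: eqP => // /cF.
Qed.

Lemma truncate0 n (c : simp n 1) (F : chain n) : (forall i, c i = ord0) -> truncate c F = 1.
Proof. by move=> c0; apply: chain0; rewrite clen_truncate c0 eqxx. Qed.

Lemma act_truncate m n (f : simp m n) (c : simp n 1) (F : chain n) :
  smon_act NDelta_plus f (truncate c F) = truncate (ordmap_comp c f) (smon_act NDelta_plus f F).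
Proof.
apply: chain_ext => [i|i j x ij xi].
  by rewrite clen_truncate ordmap_compE !clen_act clen_truncate.
have xi' : x < clen (truncate (ordmap_comp c f) (smon_act NDelta_plus f F)) i.
  by rewrite clen_truncate ordmap_compE clen_act -clen_truncate.
rewrite cmap_act // [RHS]cmap_truncate // cmap_truncate //; last exact: ordmap_mono.
by rewrite cmap_act //; move: xi'; rewrite clen_truncate; case: ifP.
Qed.

Lemma truncate_eq_act m n (f g : simp m n) (c : simp m 1) (F : chain n) :
  (forall i, c i != ord0 -> f i = g i) ->
  truncate c (smon_act NDelta_plus f F) = truncate c (smon_act NDelta_plus g F).
Proof.
move=> fg; have len i : clen (truncate c (smon_act NDelta_plus f F)) i
                      = clen (truncate c (smon_act NDelta_plus g F)) i.
  by rewrite !clen_truncate; case: eqP => // /eqP ci; rewrite !clen_act fg.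
apply: chain_ext => // i j x ij xi; have xi' := xi; rewrite len in xi'.
rewrite !cmap_truncate //; move: xi xi'; rewrite !clen_truncate; case: ifP => // /negbT ci xi xi'.
have cj : c j != ord0 by move: (ordmap_mono c ij) ci; rewrite -!val_eqE /=; lia.
by rewrite !cmap_act // !fg.
Qed.

Definition zeros n (F : chain n) : nat := #|[pred j | clen F j == 0]|.

Lemma chain_support_mono n (F : chain n) (i j : 'I_n.+1) : i <= j ->
  (if clen F i == 0 then ord0 else ord_max : 'I_2)
    <= (if clen F j == 0 then ord0 else ord_max : 'I_2).
Proof. by move=> ij; case: (eqVneq (clen F j) 0) => [/(clen_eq0 ij) ->|_] //; case: ifP. Qed.

(** For a chain in the image of [unit_arrow] this is the simplex of the interval that it
    comes from. *)
Definition chain_support n (F : chain n) : simp n 1 := mk_ordmap (@chain_support_mono n F).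

Lemma chain_supportE n (F : chain n) i :
  chain_support F i = if clen F i == 0 then ord0 else ord_max.
Proof. exact: mk_ordmapE. Qed.

Lemma chain_support_act m n (f : simp m n) (F : chain n) :
  chain_support (smon_act NDelta_plus f F) = ordmap_comp (chain_support F) f.
Proof. by apply: ordmap_ext => i; rewrite ordmap_compE !chain_supportE. Qed.

Lemma chain_support_one n i : chain_support (1 : chain n) i = ord0.
Proof. by rewrite chain_supportE clen_one. Qed.

(** The slender chains are the simplices of the image of [unit_arrow], on which a monoid is
    prescribed by its underlying coaugmented object. *)
Definition slender n (F : chain n) := [forall i, clen F i <= 1].

Lemma clen_unit_arrow m (c : simp m 1) i : clen (classify unit_arrow m c) i = c i.
Proof. by []. Qed.

Lemma chain_support_unit_arrow m (c : simp m 1) : chain_support (classify unit_arrow m c) = c.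
Proof.
by apply: eq_simp1 => i; rewrite chain_supportE clen_unit_arrow; case: (c i) => [[|[|?]] ?].
Qed.

Lemma slender_unit_arrow m (c : simp m 1) : slender (classify unit_arrow m c).
Proof. by apply/forallP => i; rewrite clen_unit_arrow -ltnS ltn_ord. Qed.

Lemma slenderE n (F : chain n) : slender F -> F = classify unit_arrow n (chain_support F).
Proof.
move=> /forallP F1; have len i : clen F i = clen (classify unit_arrow n (chain_support F)) i.
  by rewrite clen_unit_arrow chain_supportE; case: (clen F i) (F1 i) => [|[|?]].
apply: chain_ext => // i j x ij xi; have xi' := xi; rewrite len in xi'.
by have := F1 j; move: (cmap_lt ij xi) (cmap_lt ij xi'); rewrite -len; lia.
Qed.

Lemma slender_act m n (f : simp m n) (F : chain n) :
  slender F -> slender (smon_act NDelta_plus f F).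
Proof. by move=> /forallP F1; apply/forallP => i; rewrite clen_act. Qed.

Lemma slender_factor n (F : chain n) g : slender F -> g \in factors F -> slender (val g).
Proof.
by move=> /forallP F1 gF; apply/forallP => i; apply: leq_trans (factor_len i gF) (F1 i).
Qed.

(** * The free basis of a tensor with the nerve of the simplex category *)

Section TensorBasis.
Variable k : nat.

Let tcell n : eqType := (simp n k * gen n)%type.

Definition cells n (a : simp n k) (F : chain n) : seq (tcell n) := [seq (a, g) | g <- factors F].

Let tface m n (f : simp m n) (y : tcell n) : seq (tcell m) :=
  cells (ordmap_comp y.1 f) (smon_act NDelta_plus f (val y.2)).

Lemma factors_act m n (f : simp m n) (F : chain n) :
  factors (smon_act NDelta_plus f F)
    = flatten [seq factors (smon_act NDelta_plus f (val g)) | g <- factors F].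
Proof. by rewrite -{1}(factorsK F) gmulf_prod factors_prod. Qed.

Lemma cells_act m n (f : simp m n) (a : simp n k) (F : chain n) :
  cells (ordmap_comp a f) (smon_act NDelta_plus f F) = flatten [seq tface f z | z <- cells a F].
Proof. by rewrite /cells factors_act map_flatten -!map_comp. Qed.

Lemma cells_gen n (a : simp n k) (g : gen n) : cells a (val g) = [:: (a, g)].
Proof. by rewrite /cells factors_gen. Qed.

Lemma cells_len1 n (a : simp n k) (F : chain n) (F1 : clen F ord_max = 1%N) :
  cells a F = [:: (a, to_gen F1)].
Proof. exact: (cells_gen a (to_gen F1)). Qed.

Definition tensor_basis : basis.
Proof.
exists tcell tface.
- by move=> n [a g]; rewrite /tface ordmap_compm1 smon_act_id cells_gen.
- by move=> l m n b f [a g]; rewrite {1}/tface ordmap_compA smon_act_comp cells_act.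
move=> m n f [a g] /onto_last f_last; rewrite /tface.
have g1 : clen (smon_act NDelta_plus f (val g)) ord_max = 1%N.
  by rewrite clen_act f_last gen_len.
by exists (ordmap_comp a f, to_gen g1); rewrite (cells_len1 _ g1).
Defined.

Lemma tensor_faceE m n (f : simp m n) (a : simp n k) (g : gen n) :
  face f ((a, g) : tensor_basis n) = cells (ordmap_comp a f) (smon_act NDelta_plus f (val g)).
Proof. by []. Qed.

Lemma mem_cells n (a : simp n k) (F : chain n) z :
  z \in cells a F -> z.1 = a /\ z.2 \in factors F.
Proof. by case/mapP => g gF ->. Qed.

Lemma cells_one n (a : simp n k) : cells a 1 = [::].
Proof. by rewrite /cells factors_one. Qed.

Lemma cells_mul n (a : simp n k) (F G : chain n) : cells a (F * G) = cells a F ++ cells a G.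
Proof. by rewrite /cells factors_mul map_cat. Qed.
End TensorBasis.

(** * Extending a sphere of monoids along the forgetful functor *)

Lemma zerosP n (F : chain n) (i : 'I_n.+1) : (i < zeros F) = (clen F i == 0).
Proof.
rewrite /zeros (card_initial (P := [pred j | clen F j == 0])) // => {}i j ij /= /eqP j0.
by rewrite (clen_eq0 ij j0).
Qed.

Lemma zeros_le n (g : gen n) : zeros (val g) <= n.
Proof. by rewrite leqNgt (zerosP (val g) ord_max) gen_len. Qed.

(** Places with empty ordinals can be moved freely, as there is only one map out of the
    empty ordinal. *)
Lemma act_fix n (e : simp n n) (F : chain n) :
  (forall i, clen F i != 0 -> e i = i) -> (forall i, clen F i == 0 -> clen F (e i) == 0) ->
  smon_act NDelta_plus e F = F.
Proof.
move=> e1 e0; have s_id : truncate (chain_support F) F = F.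
  by apply: truncate_id => i; rewrite chain_supportE; case: eqP => // _ /(congr1 val).
have s_e : ordmap_comp (chain_support F) e = chain_support F.
  apply: ordmap_ext => i; rewrite ordmap_compE !chain_supportE.
  have [i0|i1] := boolP (clen F i == 0); first by rewrite (e0 _ i0).
  by rewrite (e1 _ i1) (negbTE i1).
rewrite -{1}s_id act_truncate s_e (@truncate_eq_act _ _ _ (ordmap_id n.+1)).
  by rewrite smon_act_id.
by move=> i; rewrite chain_supportE ordmap_idE; case: ifP => // /negbT /e1.
Qed.

(** The two components of a nondegenerate simplex of a prism are jointly injective: a
    monotone endomorphism collapsing two points on which both agree would fix it. *)
Lemma prism_nondeg_inj k r (y : prism k r) (i j : 'I_r.+1) :
  nondeg y -> y.1 i = y.1 j -> y.2 i = y.2 j -> i = j.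
Proof.
move=> y_nd; wlog le_ij : i j / i <= j.
  move=> wl y1 y2; case: (leqP i j) => [/wl|/ltnW/wl ji]; first exact.
  exact: esym (ji (esym y1) (esym y2)).
move=> y1 y2; pose e0 (x : 'I_r.+1) := if (i <= x) && (x <= j) then i else x.
have e0_mono (x x' : 'I_r.+1) : x <= x' -> e0 x <= e0 x'.
  by rewrite /e0; do 2!case: ifP; lia.
pose e : simp r r := mk_ordmap e0_mono.
have e_fix l (f : simp r l) : f i = f j -> ordmap_comp f e = f.
  move=> fij; apply: ordmap_ext => x; rewrite ordmap_compE mk_ordmapE /e0.
  case: ifP => // /andP[ix xj]; apply: ord_inj; have := ordmap_mono f ix.
  by have := ordmap_mono f xj; rewrite -fij; lia.
have e1 : e = ordmap_id r.+1.
  by apply: y_nd; have := prism_faceE e y.1 y.2; rewrite !e_fix // -surjective_pairing.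
have := mk_ordmapE e0_mono j; rewrite -/e e1 ordmap_idE /e0 le_ij leqnn.
by move=> ->.
Qed.

Section Words.
Variables (k : nat) (E : smon) (P : partial_hom (tensor_basis k) E).

Definition cells_dom n (a : simp n k) (F : chain n) : Prop :=
  forall z : tensor_basis k n, z \in cells a F -> dom P z.

Definition word_val n (a : simp n k) (F : chain n) : E n :=
  \prod_(z <- (cells a F : seq (tensor_basis k n))) pval P z.

Lemma cells_dom_act m n (f : simp m n) (a : simp n k) (F : chain n) : cells_dom a F ->
  cells_dom (ordmap_comp a f) (smon_act NDelta_plus f F).
Proof.
move=> aF z; rewrite cells_act => /flatten_mapP[y /aF yP].
exact: (dom_face (f := f) yP).
Qed.

Lemma word_val_act m n (f : simp m n) (a : simp n k) (F : chain n) : cells_dom a F ->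
  smon_act E f (word_val a F) = word_val (ordmap_comp a f) (smon_act NDelta_plus f F).
Proof. by move=> aF; rewrite /word_val prod_face // cells_act. Qed.

Lemma word_val_mul n (a : simp n k) (F G : chain n) :
  word_val a (F * G) = word_val a F * word_val a G.
Proof. by rewrite /word_val cells_mul big_cat. Qed.

Lemma word_val_one n (a : simp n k) : word_val a 1 = 1.
Proof. by rewrite /word_val cells_one big_nil. Qed.
End Words.

Section Extension.
(* [B] stands for a map from the boundary of the [k]-simplex to monoids and [H] for a prism
   of coaugmented objects, agreeing with [B] by [HB_compat]; off the boundary the
   values of [B] are arbitrary. *)
Variables (E : smon) (E_qc : strict_monoidal_infty_category E).
Variables (t : coaug E 0) (t_terminal : terminal t) (k : nat).
Variable B : forall n, simp n k -> chain n -> E n.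
Hypothesis B_act : forall m n (f : simp m n) (a : simp n k) F, in_boundary a ->
  smon_act E f (B a F) = B (ordmap_comp a f) (smon_act NDelta_plus f F).
Hypothesis B_mul : forall n (a : simp n k) F G, in_boundary a -> B a (F * G) = B a F * B a G.
Hypothesis B_one : forall n (a : simp n k), in_boundary a -> B a 1 = 1.
Variable H : forall n, simp n k -> simp n 1 -> E n.
Hypothesis H_act : forall m n (f : simp m n) (a : simp n k) c,
  smon_act E f (H a c) = H (ordmap_comp a f) (ordmap_comp c f).
Hypothesis H_bottom : forall n (a : simp n k) (c : simp n 1),
  (forall i, c i = ord0) -> H a c = 1.
Hypothesis H_last : H (ordmap_const 2 ord_max) (ordmap_id 2) = coaug_edge t.
Hypothesis HB_compat : forall n (a : simp n k) c, in_boundary a ->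
  B a (classify unit_arrow n c) = H a c.

Let Y := tensor_basis k.

Let dom0 n (y : Y n) : Prop := in_boundary (y.1 : simp n k) || slender (val y.2).
Let val0 n (y : Y n) : E n :=
  if in_boundary (y.1 : simp n k) then B y.1 (val y.2) else H y.1 (chain_support (val y.2)).

Let prod_boundary n (a : simp n k) (F : chain n) : in_boundary a ->
  \prod_(z <- (cells a F : seq (Y n))) val0 z = B a F.
Proof.
move=> a_bd; rewrite -{2}(factorsK F) /cells /gen_prod.
elim: (factors F) => [|g s IH]; first by rewrite !big_nil B_one.
by rewrite /= !big_cons IH B_mul // /val0 /= a_bd.
Qed.

Let slender_cases n (F : chain n) : slender F -> F = 1 \/ clen F ord_max = 1%N.
Proof.
move=> /forallP/(_ ord_max) F1; have [/chain0 ->|F0] := posnP (clen F ord_max); first by left.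
by right; lia.
Qed.

Let prod_slender n (a : simp n k) (F : chain n) : slender F ->
  \prod_(z <- (cells a F : seq (Y n))) val0 z = H a (chain_support F).
Proof.
move=> F1; have [a_bd|a_onto] := boolP (in_boundary a).
  by rewrite prod_boundary // {1}(slenderE F1) HB_compat.
have [->|Fn] := slender_cases F1.
  by rewrite cells_one big_nil H_bottom // => i; rewrite chain_support_one.
by rewrite (cells_len1 _ Fn) big_seq1 /val0 /= (negbTE a_onto).
Qed.

Let dom0_face m n (f : simp m n) (y : Y n) : dom0 y -> forall z, z \in face f y -> dom0 z.
Proof.
case: y => a g y0 z; rewrite tensor_faceE => /mem_cells[za zg].
rewrite /dom0 za; case/orP: y0 => /= [a_bd|g1].
  by rewrite (in_boundary_act f a_bd).
by rewrite (slender_factor (slender_act f g1) zg) orbT.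
Qed.

Let val0_face m n (f : simp m n) (y : Y n) : dom0 y ->
  smon_act E f (val0 y) = \prod_(z <- face f y) val0 z.
Proof.
case: y => a g; rewrite tensor_faceE; case/orP => /= [a_bd|g1].
  by rewrite prod_boundary ?(in_boundary_act f a_bd) // /val0 /= a_bd B_act.
have := prod_slender a g1; rewrite cells_gen big_seq1 => ->.
by rewrite (prod_slender _ (slender_act f g1)) H_act chain_support_act.
Qed.

Let P0 : partial_hom Y E := PartialHom dom0_face val0_face.

(** [i] is the last place of [y] with an empty ordinal, and the vertex at [i] is the one that
    the pairing inserts: it has the same first coordinate as the next vertex. *)
Let high_at n (y : Y n) (i j : 'I_n.+1) : Prop :=
  [/\ j = i.+1 :> nat, clen (val y.2) i = 0, clen (val y.2) j <> 0 & y.1 i = y.1 j].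

Let low n (y : Y n) : Prop :=
  [/\ ~ dom0 y, nondeg y & forall i j, ~ high_at y i j].

Let place n (y : Y n) : 'I_n.+1 := inord (zeros (val y.2)).
Let pos n (y : Y n) : 'I_n.+2 := inord (zeros (val y.2)).

Let placeE n (y : Y n) : place y = zeros (val y.2) :> nat.
Proof. by rewrite inordK // ltnS zeros_le. Qed.

Let posE n (y : Y n) : pos y = zeros (val y.2) :> nat.
Proof. by rewrite inordK // ltnW // !ltnS zeros_le. Qed.

Let ins_chain n (y : Y n) : chain n.+1 :=
  truncate (threshold n.+1 (zeros (val y.2))) (smon_act NDelta_plus (codegen (place y)) (val y.2)).

Let ins_chain_len n (y : Y n) : clen (ins_chain y) ord_max = 1%N.
Proof.
rewrite clen_truncate thresholdE ltnS zeros_le clen_act (onto_last (codegen_onto _)).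
exact: gen_len.
Qed.

Let ins n (y : Y n) : Y n.+1 :=
  (ordmap_comp y.1 (codegen (place y)), to_gen (ins_chain_len y)).

Let ins_face n (y : Y n) : face (coface (pos y)) (ins y) = [:: y].
Proof.
case: y => a g; set y := (a, g) : Y n; rewrite tensor_faceE /= /ins_chain act_truncate.
have cK : ordmap_comp (codegen (place y)) (coface (pos y)) = ordmap_id n.+1.
  by apply: codegenK; left; rewrite posE placeE.
rewrite -ordmap_compA -smon_act_comp cK ordmap_compm1 smon_act_id truncate_id ?cells_gen //.
move=> i; rewrite ordmap_compE thresholdE cofaceE /= posE.
case: ltnP => [_ /(congr1 val) //|zi _]; apply/eqP; rewrite -zerosP.
by move: zi; rewrite /bump /=; lia.
Qed.

Let codegen_place n (y : Y n) (i : 'I_n.+2) :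
  codegen (place y) i = i - (zeros (val y.2) < i) :> nat.
Proof. by rewrite codegenE /unbump placeE. Qed.

Let ins_len n (y : Y n) i : clen (val (ins y).2) i =
  if i <= zeros (val y.2) then 0 else clen (val y.2) (codegen (place y) i).
Proof. by rewrite [LHS]clen_truncate thresholdE; case: ltnP. Qed.

Let ins_high_at n (y : Y n) (i j : 'I_n.+2) :
  i = zeros (val y.2) :> nat -> j = i.+1 :> nat -> high_at (ins y) i j.
Proof.
move=> iz ji; split=> //; rewrite ?ins_len ?iz ?leqnn ?ji ?iz ?ltnn //.
  apply/eqP; rewrite -zerosP codegen_place ji iz; lia.
rewrite [LHS]ordmap_compE [RHS]ordmap_compE; congr (ordmap_fun _ _); apply: ord_inj.
by rewrite !codegen_place ji iz; lia.
Qed.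

Let ins_not_low n (y : Y n) : low y -> ~ low (ins y).
Proof.
move=> _ [_ _ not_high]; have lt_z : zeros (val y.2) <= n := zeros_le y.2.
have z1 : zeros (val y.2) < n.+2 by lia.
have z2 : (zeros (val y.2)).+1 < n.+2 by lia.
exact: (not_high (Ordinal z1) (Ordinal z2)) (ins_high_at _ _).
Qed.

Let ins_zeros n (y : Y n) : zeros (val (ins y).2) = (zeros (val y.2)).+1.
Proof.
have lt_z : zeros (val y.2) <= n := zeros_le y.2.
have lt_z' : zeros (val (ins y).2) <= n.+1 := zeros_le (ins y).2.
have z1 : zeros (val y.2) < n.+2 by lia.
have z2 : (zeros (val y.2)).+1 < n.+2 by lia.
have [_ + + _] := @ins_high_at _ y (Ordinal z1) (Ordinal z2) erefl erefl.
by move=> /eqP; rewrite -zerosP /= => ? /eqP; rewrite -zerosP /=; lia.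
Qed.

(** An endomorphism fixing [y] preserves the set of places where the chain of [y] is empty,
    hence extends to one that fixes [ins y] and the inserted vertex. *)
Let ins_nondeg n (y : Y n) : nondeg (ins y) -> nondeg y.
Proof.
case: y => a g; set y := (a, g) : Y n; move=> y_nd e; rewrite tensor_faceE => ey.
set z := zeros (val g).
have zg : z <= n := zeros_le g.
have g1 : clen (smon_act NDelta_plus e (val g)) ord_max = 1%N.
  have := congr1 size ey; rewrite /cells size_map -gen_prod_size factorsK.
  by [].
have [ae ge] : ordmap_comp a e = a /\ smon_act NDelta_plus e (val g) = val g.
  move: ey; rewrite (cells_len1 _ g1) => ey.
  split; first exact: (congr1 (fun s => (head y s).1) ey).
  exact: (congr1 (fun s : seq (Y n) => val (head y s).2) ey).
have e_zero x : (e x < z) = (x < z) by rewrite !zerosP -clen_act ge.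
pose e1 (x : 'I_n.+2) : nat :=
  if x < z then e (codegen (place y) x) : nat
  else if x == z :> nat then z else (e (codegen (place y) x)).+1.
have e1_lt x : e1 x < n.+2.
  by rewrite /e1; have := ltn_ord (e (codegen (place y) x)); case: (ltngtP x z) => _ /=; lia.
have cx x : codegen (place y) x = x - (z < x) :> nat := codegen_place y x.
have e1_mono (i j : 'I_n.+2) : i <= j -> Ordinal (e1_lt i) <= Ordinal (e1_lt j).
  move=> ij /=; have := e_zero (codegen (place y) i); have := e_zero (codegen (place y) j).
  have := ordmap_mono e (ordmap_mono (codegen (place y)) ij).
  rewrite /e1; move: (cx i) (cx j); case: (ltngtP i z) => ? /=; case: (ltngtP j z) => ? /=; lia.
pose e' : simp n.+1 n.+1 := mk_ordmap e1_mono.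
have e'E x : e' x = e1 x :> nat by rewrite mk_ordmapE.
have e'cod (x : 'I_n.+2) : x != z :> nat -> codegen (place y) (e' x) = e (codegen (place y) x).
  move=> xz; apply: ord_inj; rewrite cx e'E /e1.
  by move: xz (e_zero (codegen (place y) x)) (cx x); case: (ltngtP x z) => //= ? _; lia.
have e'_fix : face e' (ins y) = [:: ins y].
  rewrite tensor_faceE /= /ins_chain act_truncate -ordmap_compA -smon_act_comp.
  have -> : ordmap_comp (threshold n.+1 z) e' = threshold n.+1 z.
    apply: eq_simp1 => x; rewrite ordmap_compE !thresholdE.
    suff -> : (z < e' x) = (z < x) by [].
    rewrite e'E /e1.
    by move: (e_zero (codegen (place y) x)) (cx x); case: (ltngtP x z) => /= ?; lia.
  have -> : truncate (threshold n.+1 z)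
      (smon_act NDelta_plus (ordmap_comp (codegen (place y)) e') (val g)) = ins_chain y.
    rewrite (@truncate_eq_act _ _ _ (ordmap_comp e (codegen (place y)))).
      by rewrite smon_act_comp ge.
    move=> x; rewrite thresholdE !ordmap_compE; case: ltnP => // zx _.
    by apply: e'cod; rewrite neq_ltn zx orbT.
  have -> : ordmap_comp a (ordmap_comp (codegen (place y)) e') = ordmap_comp a (codegen (place y)).
    apply: ordmap_ext => x; rewrite !ordmap_compE.
    have [xz|xz] := eqVneq (x : nat) z; last by rewrite e'cod // -ordmap_compE ae.
    congr (a _); apply: ord_inj; rewrite !cx e'E /e1 xz ltnn eqxx; lia.
  exact: cells_gen (ins y).1 (ins y).2.
have e'1 := y_nd _ e'_fix.
apply: ordmap_ext => x; apply: ord_inj; rewrite ordmap_idE.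
have [xz|xz] := ltnP x z.
  have := e'E (widen_ord (leqnSn _) x); rewrite e'1 ordmap_idE /e1 /= xz => ->.
  by congr (nat_of_ord (e _)); apply: ord_inj; rewrite cx /=; lia.
have cxl : codegen (place y) (lift ord0 x) = x.
  by apply: ord_inj; rewrite cx /= /bump /=; lia.
have := e'E (lift ord0 x); rewrite e'1 ordmap_idE /e1 cxl /= /bump /= add1n.
by rewrite ltnNge ltnW //= gtn_eqF // => -[->].
Qed.

Let high_zeros n (y : Y n) i j : high_at y i j -> zeros (val y.2) = i.+1.
Proof.
move=> [ji /eqP yi /eqP/negbTE yj _]; move: yi yj; rewrite -!zerosP ji; lia.
Qed.

(** The face opposite to [i] is not high in its turn, because two consecutive vertices of
    [y] with empty ordinals and the same first coordinate would make [y] degenerate. *)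
Let high_ins n (y : Y n.+1) i j : high_at y i j -> nondeg y -> ~ dom0 y ->
  exists2 z : Y n, low z & ins z = y.
Proof.
case: y => a g y_high y_nd y_new; have g_zeros := high_zeros y_high.
have [/= ji gi gj aij] := y_high.
have lt_i : i < n.+1 by have := ltn_ord j; rewrite ji.
have last_i : lift i (ord_max : 'I_n.+1) = ord_max.
  by apply: ord_inj; rewrite /= /bump; move: lt_i; lia.
have z1 : clen (smon_act NDelta_plus (coface i) (val g)) ord_max = 1%N.
  by rewrite clen_act cofaceE last_i gen_len.
pose z : Y n := (ordmap_comp a (coface i), to_gen z1).
have z_len x : clen (val z.2) x = clen (val g) (lift i x).
  by rewrite -cofaceE.
have zi (x : 'I_n.+1) : (x < zeros (val z.2)) = (x < i).
  rewrite zerosP z_len -zerosP g_zeros /= /bump; lia.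
have z_zeros : zeros (val z.2) = i.
  have z_le : zeros (val z.2) <= n := zeros_le z.2.
  case: (ltngtP (zeros (val z.2)) i) => // lt_zi.
    by have := zi (Ordinal (z_le : zeros (val z.2) < n.+1)); rewrite /= ltnn lt_zi.
  by have := zi (Ordinal lt_i); rewrite /= ltnn lt_zi.
have insz : ins z = (a, g).
  have placei : place z = i :> nat by rewrite placeE z_zeros.
  have lift_place (x : 'I_n.+2) : x != i -> lift i (codegen (place z) x) = x.
    move=> xi; apply: ord_inj; rewrite /= codegenE placei /bump /unbump.
    by move: xi; rewrite -val_eqE /=; lia.
  congr pair.
    apply: ordmap_ext => x; rewrite !ordmap_compE cofaceE.
    have [->|xi] := eqVneq x i; last by rewrite lift_place.
    rewrite aij; congr (a _); apply: ord_inj.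
    by rewrite /= codegenE placei /bump /unbump ji; lia.
  apply: val_inj; transitivity (ins_chain z); first by [].
  rewrite /ins_chain z_zeros -[val z.2]/(smon_act NDelta_plus (coface i) (val g)) -smon_act_comp.
  rewrite (@truncate_eq_act _ _ _ (ordmap_id n.+2)) ?smon_act_id ?truncate_id // => x.
    rewrite thresholdE; case: ltnP => [_ /(congr1 val) //|xi _].
    by apply/eqP; rewrite -zerosP g_zeros.
  rewrite thresholdE ordmap_compE cofaceE ordmap_idE; case: ltnP => // ix _.
  by apply: lift_place; rewrite -val_eqE /=; lia.
exists z => //; split.
- move=> z_dom; apply: y_new; rewrite /dom0 /=; case/orP: z_dom => /= [z_bd|/forallP z1'].
    apply/orP; left; case/existsP: z_bd => v /forallP vz; apply/existsP; exists v.
    apply/forallP => x; have [w wx] : exists w, a x = a (lift i w).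
      case: (unliftP i x) => [w ->|->]; first by exists w.
      exists (codegen (inord i) j); rewrite aij; congr (a _); apply: ord_inj.
      by rewrite /= codegenE inordK // ji /bump /unbump; lia.
    by have := vz w; rewrite ordmap_compE cofaceE wx.
  apply/orP; right; apply/forallP => x; case: (unliftP i x) => [w ->|->]; last by rewrite gi.
  by have := z1' w; rewrite z_len.
- by apply: ins_nondeg; rewrite insz.
move=> x x' [x'x zx zx' axx'].
have {}zx : x < i by rewrite -zi zerosP; apply/eqP.
have {}zx' : x' = i :> nat.
  by move/eqP/negbTE: zx'; rewrite -zerosP zi x'x; lia.
pose r : 'I_n.+1 := x; have r1i : r.+1 = i :> nat by rewrite -zx' x'x.
have lx : lift i x = r :> nat by rewrite /= /bump; lia.
have lx' : lift i x' = j by apply: ord_inj; rewrite /= /bump ji zx' leqnn.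
have a_fix : ordmap_comp a (collapse r) = a.
  apply: (collapse_absorb (i := lift i x) (j := i)) => //.
  by rewrite aij -lx' -!cofaceE -!ordmap_compE.
have g_fix : smon_act NDelta_plus (collapse r) (val g) = val g.
  apply: act_fix => w; rewrite -!zerosP g_zeros => wi; last first.
    by rewrite collapse_lt; case: ifP; lia.
  by apply: ord_inj; rewrite collapse_lt; case: eqP; lia.
have := y_nd (collapse r); rewrite tensor_faceE a_fix g_fix cells_gen => /(_ erefl).
move/(congr1 (fun f : simp n.+1 n.+1 => f i : nat)).
by rewrite collapse_lt ordmap_idE r1i eqxx; lia.
Qed.

Section Saturation.
Variable P : partial_hom Y E.
Hypothesis P0P : ple P0 P.
Hypothesis P_closed : forall n (y : Y n) v, low y ->
  (forall m (f : simp m n.+1), in_horn (pos y) f -> faces_in P f (ins y) v) ->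
  dom P (ins y).

(* The number of vertices of [y] with nonempty ordinal. *)
Let cnt n (y : Y n) : nat := n.+1 - zeros (val y.2).

Variable q : nat.
Hypothesis below_q : forall n (y : Y n), cnt y < q -> dom P y.

(** A face opposite to a vertex before [i] is again high, with as many nonempty ordinals. A
    face opposite to a vertex after [i] has fewer of them, and so has every factor of the
    last face. *)
Let high_faces n (y : Y n.+1) i j : high_at y i j -> cnt y <= q ->
  (forall (z : Y n) i' j', high_at z i' j' -> cnt z <= q -> dom P z) ->
  forall m (f : simp m n.+1), in_horn i f -> forall z, z \in face f y -> dom P z.
Proof.
move=> y_high y_cnt IHn m f /in_hornP[l [f' [li ->]]] z /face_compP[x xy zx].
apply: (dom_face _ zx) => {f f' z zx}; case: y x y_high y_cnt xy => a g [b h] y_high.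
have g_zeros := high_zeros y_high; have [ji gi gj aij] := y_high.
rewrite tensor_faceE /cnt g_zeros => y_cnt /mem_cells[hb hg].
have lt_i : i < n.+1 by have := ltn_ord j; rewrite ji.
have h_len w : clen (val h) w <= clen (val g) (lift l w).
  by rewrite -cofaceE -clen_act; apply: factor_len.
have h_zero (w : 'I_n.+1) : lift l w <= i -> w < zeros (val h).
  move=> wi; rewrite zerosP -leqn0; apply: leq_trans (h_len w) _.
  by rewrite leqn0 -zerosP g_zeros.
have [lt_li|le_il] := ltnP l i; last first.
  apply: below_q; rewrite /cnt /=.
  have := @h_zero (Ordinal lt_i); rewrite /= /bump.
  by move: li; rewrite -val_eqE /=; lia.
have l_max : lift l (ord_max : 'I_n.+1) = ord_max.
  by apply: ord_inj; rewrite /= /bump; lia.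
have g1 : clen (smon_act NDelta_plus (coface l) (val g)) ord_max = 1%N.
  by rewrite clen_act cofaceE l_max gen_len.
have hE w : clen (val h) w = clen (val g) (lift l w).
  move: hg; rewrite -cofaceE -clen_act -[smon_act _ _ _]/(val (to_gen g1)) factors_gen.
  by rewrite inE => /eqP hE; rewrite [h]hE.
have i_gt0 : 0 < i by lia.
have lt_i1 : i.-1 < n.+1 by lia.
have li1 : lift l (Ordinal lt_i1) = i by apply: ord_inj; rewrite /= /bump; lia.
have lj1 : lift l (Ordinal lt_i) = j by apply: ord_inj; rewrite /= /bump; lia.
apply: (IHn _ (Ordinal lt_i1) (Ordinal lt_i)).
  split; rewrite ?hE ?li1 ?lj1 //=; first by lia.
  by rewrite [b]hb !ordmap_compE !cofaceE li1 lj1.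
rewrite /cnt /=; have := @h_zero (Ordinal lt_i1); rewrite li1 leqnn /= => /(_ isT).
by lia.
Qed.

(** The case of [horn_under_unit]. Each cell of the cone on the prism over the boundary of
    the missing face is a degeneracy of a cell that takes each vertex of the top at most
    once and misses one of them; it therefore has fewer nonempty ordinals than [y]. *)
Let initial_horn_filler m (y : Y m.+2) j :
  high_at y ord0 j -> cnt y <= q -> ~~ in_boundary (y.1 : simp m.+2 k) ->
  (forall r (f : simp r m.+2), in_horn ord0 f -> forall z, z \in face f y -> dom P z) ->
  exists v, forall r (f : simp r m.+2), in_horn ord0 f -> faces_in P f y v.
Proof.
case: y => a g y_high; have g_zeros := high_zeros y_high.
rewrite /cnt g_zeros => y_cnt a_onto y_horn.
have g0 : clen (val g) ord0 = 0 by case: y_high.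
pose cut r (f : simp r m.+2) (c : simp r 1) := truncate c (smon_act NDelta_plus f (val g)).
pose W r (f : simp r m.+2) (c : simp r 1) := word_val P (ordmap_comp a f) (cut r f c).
have cut_dom r (f : simp r m.+2) (c : simp r 1) : in_horn ord0 f ->
    cells_dom P (ordmap_comp a f) (cut r f c).
  move=> /existsP[l /andP[l0 /forallP fl]].
  have [r' [s [[f' c'] [s_onto]]]] := nondeg_factor ((f, c) : prism m.+2 r).
  rewrite prism_faceE => -[fE cE] y_nd.
  rewrite /cut -fE -cE smon_act_comp -act_truncate ordmap_compA.
  apply: cells_dom_act => -[b h] /mem_cells[_ /= hF]; apply: below_q; rewrite /cnt /=.
  apply: leq_trans y_cnt.
  pose A := [pred x : 'I_r'.+1 | clen (val h) x != 0].
  have A_c x : x \in A -> c' x != ord0 /\ f' x != ord0.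
    rewrite inE => hx; have := factor_len x hF; rewrite clen_truncate clen_act.
    case: eqP => [_|_ gx]; first by rewrite leqn0 (negbTE hx).
    by split=> //; apply: contraTneq gx => ->; rewrite g0 leqn0.
  have A_inj : {in A &, injective f'}.
    move=> x x' /A_c[cx _] /A_c[cx' _] fxx'; apply: (prism_nondeg_inj y_nd fxx').
    by move: cx cx' => /=; case: (c' x) (c' x') => [[|[|?]] ?] [[|[|?]] ?] // _ _; apply: ord_inj.
  have A_card : #|A| <= m.+1.
    rewrite -(card_in_image A_inj).
    apply: (@leq_trans #|predC (pred2 (ord0 : 'I_m.+3) l)|).
      apply/subset_leq_card/fintype.subsetP => v v_im.
      have [x xA ->] := fintype.imageP v_im.
      have [_ fx0] := A_c x xA.
      rewrite !inE negb_or fx0 /=; have [w <-] := ontoP s_onto x.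
      by rewrite -ordmap_compE fE fl.
    rewrite -(leq_add2l #|pred2 (ord0 : 'I_m.+3) l|) cardC card_ord card2 eq_sym l0.
    by rewrite add2n.
  have : zeros (val h) + #|A| = r'.+1.
    by rewrite -[RHS]card_ord -(cardC [pred x | clen (val h) x == 0]).
  by move: A_card => /=; lia.
have [|||w wE] := @horn_under_unit E E_qc t t_terminal m W.
- move=> r s f' f c f_horn; rewrite /W word_val_act; last exact: cut_dom.
  by rewrite /cut act_truncate -smon_act_comp ordmap_compA.
- by move=> r f c _ c0; rewrite /W /cut truncate0 ?word_val_one.
- have a_last : ordmap_comp a (ordmap_const 2 ord_max) = ordmap_const 2 ord_max.
    by apply: ordmap_ext => x; rewrite ordmap_compE !mk_ordmapE onto_last.
  set F := cut _ (ordmap_const 2 ord_max) (ordmap_id 2).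
  have F_len i : clen F i = i.
    rewrite clen_truncate ordmap_idE clen_act mk_ordmapE gen_len.
    by case: i => [[|[|?]] ?].
  have F1 : slender F by apply/forallP => i; rewrite F_len -ltnS.
  rewrite -H_last /W a_last -/F.
  have -> : ordmap_id 2 = chain_support F.
    apply: eq_simp1 => i; rewrite ordmap_idE chain_supportE F_len.
    by case: i => [[|[|?]] ?].
  rewrite -prod_slender //; apply: eq_big_seq => z /mem_cells[_ zF].
  have z_dom : dom P0 z by rewrite /= /dom0 (slender_factor F1 zF) orbT.
  by have [] := P0P z_dom.
exists w => r f f_horn; split; first exact: y_horn.
rewrite wE // /W /cut truncate_id // => i; rewrite ordmap_compE thresholdE.
case: ltnP => [_ /(congr1 val) //|fi _]; rewrite clen_act.
by have -> : f i = ord0 by apply: ord_inj => /=; lia.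
Qed.

Let initial_filler n (y : Y n.+1) j : high_at y ord0 j -> cnt y <= q -> ~ dom0 y ->
  (forall r (f : simp r n.+1), in_horn ord0 f -> forall z, z \in face f y -> dom P z) ->
  exists v, forall r (f : simp r n.+1), in_horn ord0 f -> faces_in P f y v.
Proof.
case: n y j => [|n] y j y_high y_cnt y_new y_horn; last first.
  apply: initial_horn_filler y_high y_cnt _ y_horn.
  by apply/negP => y_bd; apply: y_new; rewrite /dom0 y_bd.
case: y_new; apply/orP; right; apply/forallP => x.
have [->|x0] := eqVneq x ord0; first by have [_ -> _ _] := y_high.
have -> : x = ord_max by apply: ord_inj; move: (ltn_ord x) x0; rewrite -val_eqE /=; lia.
by rewrite (gen_len y.2).
Qed.

Let high_dom n (y : Y n) i j : high_at y i j -> cnt y <= q -> dom P y.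
Proof.
elim: n y i j => [|n IHn] y i j y_high y_cnt.
  by case: y_high => ji _ _ _; have := ltn_ord j; rewrite ji.
have y_horn := high_faces y_high y_cnt IHn.
have [y0|y_new] := pselect (dom0 y); first by case: (P0P (y0 : dom P0 y)).
have [y_nd|] := pselect (nondeg y); last exact: (degenerate_dom (k := i)).
have [z z_low zy] := high_ins y_high y_nd y_new.
have pos_i : pos z = i.
  apply: ord_inj; rewrite posE; apply: succn_inj.
  by rewrite -ins_zeros zy (high_zeros y_high).
suff [v v_horn] : exists v, forall m (f : simp m n.+1), in_horn i f -> faces_in P f y v.
  by rewrite -zy; apply: (P_closed (v := v)) => //; rewrite pos_i zy.
have lt_i : i < n.+1 by case: y_high => ji _ _ _; have := ltn_ord j; rewrite ji.
have [i_gt0|] := ltnP 0 i.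
  by apply: (inner_horn_filler E_qc (k := i)) => //; rewrite i_gt0.
rewrite leqn0 => i0; have {}i0 : i = ord0 by apply: ord_inj; exact: eqP i0.
rewrite i0 in y_high y_horn *; exact: initial_filler y_high y_cnt y_new y_horn.
Qed.

(** The low cells come last: each is a face of a high cell with as many nonempty
    ordinals. *)
Lemma bounded_dom n (y : Y n) : cnt y <= q -> dom P y.
Proof.
elim: n y => [|n IH] y y_cnt.
all: have [y0|y_new] := pselect (dom0 y); first by case: (P0P (y0 : dom P0 y)).
  case: y_new; apply/orP; right; apply/forallP => x.
  by rewrite [x]ord1 -[ord0](ord1 ord_max) (gen_len y.2).
have [y_nd|y_deg] := pselect (nondeg y); last first.
  have [r /(_ (lift ord0 r))[|z yz zy]] := degenerate_face y_deg; first by right.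
  suff zP : dom P z.
    by apply: (dom_face (f := codegen r : simp n.+1 n) zP); rewrite zy mem_head.
  apply: IH; apply: leq_trans y_cnt; rewrite /cnt.
  have z_le : zeros (val z.2) <= n := zeros_le z.2.
  have y_le : zeros (val y.2) <= n.+1 := zeros_le y.2.
  have z_len w : clen (val z.2) w <= clen (val y.2) (lift (lift ord0 r) w).
    rewrite -cofaceE -clen_act; apply: factor_len.
    have : z \in face (coface (lift ord0 r) : simp n n.+1) y by rewrite yz mem_head.
    by rewrite [y]surjective_pairing tensor_faceE => /mem_cells[].
  have [y2|y2] := ltnP 1 (zeros (val y.2)); last by lia.
  have lt_w : (zeros (val y.2)).-2 < n.+1 by lia.
  suff : (zeros (val y.2)).-2 < zeros (val z.2) by lia.
  rewrite (zerosP _ (Ordinal lt_w)) -leqn0; apply: leq_trans (z_len _) _.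
  rewrite leqn0 -zerosP; apply: (@leq_ltn_trans (zeros (val y.2)).-2.+1); last by lia.
  by rewrite -[X in _ <= X]add1n leq_add2r leq_b1.
have [[i [j y_high]]|y_flat] := pselect (exists i j, high_at y i j).
  exact: high_dom y_high y_cnt.
have y_low : low y by split=> // i j y_high; apply: y_flat; exists i, j.
have lt_z : zeros (val y.2) <= n.+1 := zeros_le y.2.
have z1 : zeros (val y.2) < n.+3 by lia.
have z2 : (zeros (val y.2)).+1 < n.+3 by lia.
have insP : dom P (ins y).
  apply: (@high_dom _ _ (Ordinal z1) (Ordinal z2)); first exact: ins_high_at.
  by rewrite /cnt ins_zeros subSS.
by apply: (dom_face (f := coface (pos y) : simp n.+1 n.+2) insP); rewrite ins_face mem_head.
Qed.

End Saturation.

Let saturated (P : partial_hom Y E) : ple P0 P ->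
  (forall n (y : Y n) v, low y ->
    (forall m (f : simp m n.+1), in_horn (pos y) f -> faces_in P f (ins y) v) ->
    dom P (ins y)) ->
  forall n (y : Y n), dom P y.
Proof.
move=> P0P P_closed n y; have := leqnn (n.+1 - zeros (val y.2)).
move: {2}(_ - _) => q; elim/ltn_ind: q n y => q IH n y y_cnt.
by apply: (bounded_dom P0P P_closed (q := q)) => // m z lt_z; apply: (IH _ lt_z).
Qed.

Theorem monoid_extension : exists phi : forall n, simp n k -> chain n -> E n,
  [/\ forall m n (f : simp m n) (a : simp n k) F,
        smon_act E f (phi n a F) = phi m (ordmap_comp a f) (smon_act NDelta_plus f F),
      forall n (a : simp n k) F G, phi n a (F * G) = phi n a F * phi n a G,
      forall n (a : simp n k), phi n a 1 = 1,
      forall n (a : simp n k) F, in_boundary a -> phi n a F = B a F &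
      forall n (a : simp n k) c, phi n a (classify unit_arrow n c) = H a c].
Proof.
have low_nondeg n (y : Y n) : low y -> nondeg y by case.
have low_new n (y : Y n) : low y -> ~ dom P0 y by case.
have [P [P0P P_closed]] :=
  pairing_extension (fun n y _ => @ins_face n y) low_nondeg ins_not_low low_new.
have P_all := saturated P0P P_closed; exists (@word_val k E P); split.
- by move=> m n f a F; apply: word_val_act => z _.
- exact: word_val_mul.
- exact: word_val_one.
- move=> n a F a_bd; rewrite -prod_boundary //; apply: eq_big_seq => z /mem_cells[za _].
  have z_dom : dom P0 z by rewrite /= /dom0 za a_bd.
  by have [] := P0P _ _ z_dom.
- move=> n a c; have c1 := slender_unit_arrow c.
  rewrite -{2}(chain_support_unit_arrow c) -prod_slender //.
  apply: eq_big_seq => z /mem_cells[_ zF].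
  have z_dom : dom P0 z by rewrite /= /dom0 (slender_factor c1 zF) orbT.
  by have [] := P0P _ _ z_dom.
Qed.
End Extension.

(** * The space of monoid structures *)

Section TensorMaps.
Variables (k : nat) (E : smon) (phi : forall n, simp n k -> chain n -> E n).
Hypothesis phi_act : forall m n (f : simp m n) (a : simp n k) F,
  smon_act E f (phi a F) = phi (ordmap_comp a f) (smon_act NDelta_plus f F).
Hypothesis phi_mul : forall n (a : simp n k) F G, phi a (F * G) = phi a F * phi a G.
Hypothesis phi_one : forall n (a : simp n k), phi a 1 = 1.

Let leg n (a : simp n k) (F : NDelta_plus n) : E n := phi a F.
Fact leg_morph n (a : simp n k) : monoid_morphism (leg a).
Proof. by split=> [|F G]; [apply: phi_one | apply: phi_mul]. Qed.
HB.instance Definition _ n (a : simp n k) :=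
  isUMagmaMorphism.Build (NDelta_plus n) (E n) (leg a) (leg_morph a).
Let leg_hom n (a : simp n k) : {monoid_hom NDelta_plus n -> E n} := leg a.

Lemma tensor_desc : exists Phi : mon_infty E k,
  forall n (a : simp n k) (F : chain n),
    Phi n (tensor_in (S := std_simplex k) NDelta_plus a F) = phi a F.
Proof.
pose ob n : {monoid_hom tensor (std_simplex k) NDelta_plus n -> E n} :=
  coprod_desc (fun a : std_simplex k n => leg_hom a).
have obE n (a : simp n k) (F : chain n) :
  ob n (tensor_in (S := std_simplex k) NDelta_plus a F) = phi a F by exact: coprod_desc_in.
have ob_nat m n (f : simp m n) x :
    ob m (smon_act (tensor (std_simplex k) NDelta_plus) f x) = smon_act E f (ob n x).
  apply: (@coprod_hom_eq _ _ _ (ob m \o tensor_act (std_simplex k) NDelta_plus f)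
            (smon_act E f \o ob n)) x => a F /=.
  rewrite [X in smon_act E f X]obE phi_act -[RHS]obE.
  exact: (congr1 (ob m) (@tensor_act_in (std_simplex k) NDelta_plus m n f a F)).
by exists (SMonHom ob_nat).
Qed.
End TensorMaps.

Section SphereExtension.
Variables (E : smon) (E_qc : strict_monoidal_infty_category E).
Variables (t : coaug E 0) (t_terminal : terminal t) (k : nat).

(** [monoid_extension] with its functions of chains read as morphisms from tensors. *)
Theorem forget_sphere_extension (b : sset_hom (boundary k) (mon_infty E)) (H : coaug E k) :
  (forall n (a : boundary k n), forget E n (b n a) = act (sval a) H) ->
  act (ordmap_const 1 ord_max : simp 0 k) H = t ->
  exists2 Phi : mon_infty E k, forget E k Phi = H
    & forall n (a : boundary k n), act (sval a) Phi = b n a.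
Proof.
move=> bH H_last.
pose Bv n (a : simp n k) (F : chain n) : E n :=
  if pselect (in_boundary a) is left a_bd
  then b n (exist _ a a_bd) n (tensor_in (S := std_simplex n) NDelta_plus (ordmap_id n.+1) F)
  else 1.
have BvE n (a : boundary k n) (F : chain n) : Bv n (sval a) F =
    b n a n (tensor_in (S := std_simplex n) NDelta_plus (ordmap_id n.+1) F).
  rewrite /Bv; case: pselect => [a_bd|]; last by case: (svalP a).
  by congr (b n _ n _); apply: sval_inj.
have Bv_comp m n (f : simp m n) (a : boundary k n) (F : chain m) : Bv m (ordmap_comp (sval a) f) F =
    b n a m (tensor_in (S := std_simplex n) NDelta_plus f F).
  rewrite -[ordmap_comp _ _]/(sval (act f a)) BvE sset_nat.
  by rewrite [LHS]smon_map_actE ordmap_compm1.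
have Bv_one n (a : simp n k) : in_boundary a -> Bv n a 1 = 1.
  by move=> a_bd; rewrite (BvE n (exist _ a a_bd)) !gmulf1.
have Bv_mul n (a : simp n k) F G : in_boundary a -> Bv n a (F * G) = Bv n a F * Bv n a G.
  by move=> a_bd; rewrite !(BvE n (exist _ a a_bd)) !gmulfM.
have Bv_act m n (f : simp m n) (a : simp n k) F : in_boundary a ->
    smon_act E f (Bv n a F) = Bv m (ordmap_comp a f) (smon_act NDelta_plus f F).
  move=> a_bd; rewrite (BvE n (exist _ a a_bd)) (Bv_comp m n f (exist _ a a_bd)) -smon_nat.
  by rewrite [X in b _ _ _ X]tensor_act_in /= ordmap_comp1m.
pose Hv n (a : simp n k) (c : simp n 1) : E n := sval H n (a, c).
have Hv_act m n (f : simp m n) (a : simp n k) c :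
    smon_act E f (Hv n a c) = Hv m (ordmap_comp a f) (ordmap_comp c f).
  by rewrite /Hv -[LHS](sset_nat (sval H)).
have Hv_bottom n (a : simp n k) (c : simp n 1) : (forall i, c i = ord0) -> Hv n a c = 1.
  move=> c0; have K0 : eval0 E k (sval H) = 1 :> E k by rewrite -(degen_unit E k); apply: (svalP H).
  have := congr1 (smon_act E a) K0; rewrite gmulf1 => <-.
  rewrite -[RHS](sset_nat (sval H)) /= ordmap_comp1m /Hv.
  set d := ordmap_comp _ a; have -> // : c = d.
  by apply: ordmap_ext => i; rewrite /d !ordmap_compE mk_ordmapE c0.
have Hv_last : Hv 1%N (ordmap_const 2 ord_max) (ordmap_id 2) = coaug_edge t.
  rewrite /coaug_edge -H_last /= /Hv; congr (sval H _ (_, _)).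
  by apply: ordmap_ext => i; rewrite ordmap_compE !mk_ordmapE.
have compat n (a : simp n k) c : in_boundary a -> Bv n a (classify unit_arrow n c) = Hv n a c.
  move=> a_bd; rewrite (BvE n (exist _ a a_bd)).
  have := congr1 (fun h : coaug E n => sval h n (ordmap_id n.+1, c)) (bH n (exist _ a a_bd)).
  by rewrite /= ordmap_compm1.
have [phi [phi_act phi_mul phi_one phi_B phi_H]] :=
  monoid_extension E_qc t_terminal Bv_act Bv_mul Bv_one Hv_act Hv_bottom Hv_last compat.
have [Phi PhiE] := tensor_desc phi_act phi_mul phi_one.
exists Phi => [|n a].
  apply: sval_inj; apply: sset_hom_ext => n [a c].
  by rewrite [LHS]PhiE phi_H.
apply: tensor_hom_ext => m f F; rewrite [LHS]smon_map_actE PhiE phi_B.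
  by rewrite Bv_comp.
exact: (in_boundary_act f (svalP a)).
Qed.
End SphereExtension.

(** A horn is completed by filling the sphere bounding its missing face and then the
    sphere so obtained. *)
Lemma contractible_kan (X : sset) : contractible X -> kan_complex X.
Proof.
move=> X_contr n k h.
pose d m (f : boundary n m) : horn k m :=
  exist _ (ordmap_comp (coface k) (sval f)) (etrans (boundary_coface k _) (svalP f)).
have d_nat l m (a : simp l m) (f : boundary n m) : d l (act a f) = act a (d m f).
  by apply: sval_inj; rewrite /= ordmap_compA.
have [s sd] := X_contr n (sset_comp h (SSetHom d_nat)).
have sE m (f : boundary n m) : s m (sval f) = h m (d m f).
  exact: (congr1 (fun u : sset_hom (boundary n) X => u m f) sd).
have [p kp] : exists p : 'I_n.+1, k = p :> nat \/ k = p.+1 :> nat.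
  have [lt_k|le_k] := ltnP k n.+1; first by exists (Ordinal lt_k); left.
  by exists ord_max; right; have := ltn_ord k; rewrite /=; lia.
pose ob m (f : boundary n.+1 m) : X m :=
  if pselect (in_horn k (sval f)) is left fk then h m (exist _ (sval f) fk)
  else s m (ordmap_comp (codegen p) (sval f)).
have ob_horn m (f : boundary n.+1 m) (fk : in_horn k (sval f)) :
    ob m f = h m (exist _ (sval f) fk).
  by rewrite /ob; case: pselect => // fk'; congr (h m _); apply: sval_inj.
have ob_face m (f : boundary n.+1 m) (g : simp m n) :
    sval f = ordmap_comp (coface k) g -> ob m f = s m g.
  move=> fg; rewrite /ob; case: pselect => [fk|_]; last first.
    by rewrite fg ordmap_compA codegenK // ordmap_comp1m.
  have g_bd : in_boundary g by rewrite -(boundary_coface k) -fg.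
  by rewrite -[g]/(sval (exist _ g g_bd : boundary n m)) sE; congr (h m _); apply: sval_inj.
have ob_nat l m (a : simp l m) (f : boundary n.+1 m) : ob l (act a f) = act a (ob m f).
  have [fk|fk] := boolP (in_horn k (sval f)).
    rewrite (ob_horn _ f fk) (ob_horn _ (act a f) (in_horn_act a fk)) -(sset_nat h).
    by congr (h l _); apply: sval_inj.
  have [g fg] := boundary_not_horn (svalP f) fk.
  rewrite (ob_face _ f g fg) -(sset_nat s); apply: ob_face.
  by rewrite /= fg ordmap_compA.
have [S Sob] := X_contr n.+1 (SSetHom ob_nat).
exists S; apply: sset_hom_ext => m [f fk].
have := congr1 (fun u : sset_hom (boundary n.+1) X => u m (exist _ f (horn_boundary fk))) Sob.
by rewrite /= (ob_horn _ (exist _ f (horn_boundary fk)) fk).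
Qed.

Lemma extends_classify n (X : sset) (h : sset_hom (boundary n) X) (x : X n) :
  (forall m (f : boundary n m), act (sval f) x = h m f) -> extends (boundary_incl n) h.
Proof. by move=> xh; exists (classify x); apply: sset_hom_ext => m f; apply: xh. Qed.

Lemma degen0 (X : sset) (x : X 0) : degen x 0 = x.
Proof.
rewrite -[RHS]act_id; congr act; apply: ordmap_ext => i.
by rewrite mk_ordmapE ordmap_idE [i]ord1.
Qed.

Lemma act_degen (X : sset) (x : X 0) m n (f : simp m n) : act f (degen x n) = degen x m.
Proof.
by rewrite /degen -act_comp; congr act; apply: ordmap_ext => i; rewrite ordmap_compE !mk_ordmapE.
Qed.

Theorem theorem3p12 (E : smon) (hE : strict_monoidal_infty_category E)
    (t : coaug E 0) (ht : terminal t) :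
  (forall M : mon_infty_on t 0, terminal (fiber_incl (forget E) t 0 M)) /\
  inhabited (mon_infty_on t 0) /\
  kan_complex (mon_infty_on t) /\
  contractible (mon_infty_on t).
Proof.
have fiber_contractible : contractible (mon_infty_on t).
  move=> n h; pose b := sset_comp (fiber_incl (forget E) t) h.
  have bt m (a : boundary n m) : forget E m (b m a) = act (sval a) (degen t n).
    by rewrite act_degen; apply: (svalP (h m a)).
  have [|Phi Phi_t Phi_b] := forget_sphere_extension hE ht bt.
    by rewrite act_degen degen0.
  apply: (@extends_classify n _ h (exist _ Phi Phi_t)) => m a.
  by apply: sval_inj; apply: Phi_b.
split; last first.
  split; last by split; [apply: contractible_kan|].
  (* A filler of the empty boundary of the point is an inhabitant. *)
  have no_cell m : boundary 0 m -> False.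
    by case=> f /existsP[j /forallP/(_ ord0)]; rewrite [f ord0]ord1 [j]ord1 eqxx.
  have empty_nat m l (f : simp m l) (x : boundary 0 l) :
    match no_cell m (act f x) with end = act f (match no_cell l x with end : mon_infty_on t l).
    by case: (no_cell l x).
  have [s _] := fiber_contractible 0 (SSetHom empty_nat).
  by constructor; exact: s 0 (ordmap_id 1).
move=> M n h hM.
have [|s sh] := ht n (sset_comp (forget E) h).
  by rewrite /= hM -[RHS]degen0; exact: (svalP M).
have sE m (a : boundary n.+1 m) : forget E m (h m a) = act (sval a) (s n.+1 (ordmap_id n.+2)).
  rewrite -sset_nat /= ordmap_comp1m.
  exact: (esym (congr1 (fun u : sset_hom (boundary n.+1) (coaug E) => u m a) sh)).
have [|Phi _ Phi_h] := forget_sphere_extension hE ht sE; last exact: extends_classify Phi_h.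
rewrite -(sE 0 (boundary_vertex ord_max)) hM -[RHS]degen0.
exact: (svalP M).
Qed.
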